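(* Let $\gamma>0$ and $r\in\mathbb N$. Then there exists an integer $n_0=n_0(\gamma,r)$ such that the following holds. Suppose that $G$ is a graph on $n\ge n_0$ vertices, where $r$ divides $n$, with degree sequence $d_1\le\dots\le d_n$ such that $$d_i\ge \frac{(r-2)n}{r}+i+\gamma n\quad\text{for all } i<n/r.$$ Then $G$ contains a perfect $K_r$-packing.
   Context: Graphs are finite and simple, and $\mathbb N$ denotes the positive integers. The degree sequence $d_1\le\dots\le d_n$ lists the vertex degrees of $G$ in non-decreasing order; the index $i$ ranges over positive integers. An $H$-packing in $G$ is a collection of vertex-disjoint copies of $H$ in $G$ (as not necessarily induced subgraphs); it is perfect if it covers all vertices of $G$. $K_r$ is the complete graph on $r$ vertices. *)

(* Defs.v *)
From HB Require Import structures.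
From mathcomp Require Import all_boot all_order all_algebra.
From mathcomp Require Import reals.

Set Implicit Arguments.
Unset Strict Implicit.
Unset Printing Implicit Defensive.

Record sgraph := SGraph {
  vertex :> finType;
  adj : rel vertex;
  adj_sym : symmetric adj;
  adj_irrefl : irreflexive adj
}.

Arguments adj {G} : rename.

Definition degree (G : sgraph) (x : G) : nat := #|[set y : G | adj x y]|.

Definition degree_seq (G : sgraph) : seq nat :=
  sort leq [seq degree x | x <- enum G].

(* The i-th smallest degree, counting from i = 1 (while nth counts from 0);
   only meaningful for 1 <= i <= #|G|. *)
Definition deg_at (G : sgraph) (i : nat) : nat := nth 0 (degree_seq G) i.-1.

Lemma neq_sym (T : eqType) : symmetric (fun x y : T => x != y).
Proof. by move=> x y; rewrite eq_sym. Qed.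

Lemma neq_irrefl (T : eqType) : irreflexive (fun x y : T => x != y).
Proof. by move=> x; rewrite eqxx. Qed.

Definition complete_graph (r : nat) : sgraph :=
  @SGraph 'I_r (fun x y => x != y) (@neq_sym 'I_r) (@neq_irrefl 'I_r).

(* A copy of H in G, as a not necessarily induced subgraph, is given by an
   injective edge-preserving map H -> G. *)
Definition is_copy (H G : sgraph) (f : {ffun H -> G}) : Prop :=
  injective f /\ (forall x y : H, adj x y -> adj (f x) (f y)).

(* Two maps parametrizing the same (nonempty) copy meet, so disjointness of
   distinct members makes P a set of vertex-disjoint subgraphs. *)
Definition is_packing (H G : sgraph) (P : {set {ffun H -> G}}) : Prop :=
  (forall f, f \in P -> is_copy f) /\
  (forall f g, f \in P -> g \in P -> f != g -> [disjoint codom f & codom g]).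

Definition is_perfect_packing (H G : sgraph) (P : {set {ffun H -> G}}) : Prop :=
  is_packing P /\ (forall x : G, exists2 f, f \in P & x \in codom f).

(* Main.v *)
(* Absorbing method. Almost perfect packing: cover V(G) by disjoint complete
   multipartite blocks with at most r parts, all of the same size t, plus a small
   set U of uncovered vertices. If a vertex u of U sees a positive proportion of
   every part of a block, it can be inserted (for an r-partite block because
   K_{r+1}(rt) splits into r+1 copies of K_r(t)); if it sees all parts but one, it
   can be exchanged with vertices of that part. By the degree condition, each u of
   index k admits many insertions, or else many exchanges against vertices of index
   well above k. Only boundedly many adjacency patterns between a vertex and a
   block occur, so by pigeonhole many vertices of U act on a block in the same way,
   and the operation can be performed on whole blocks, with t divided by a constant
   h. Each round decreases a bounded potential by a fixed proportion, so boundedly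
   many rounds suffice and the regularity lemma is not needed.

   Absorption: a vertex x of index k lies with many (r-1)-cliques in a K_r, and
   these cliques also extend by many vertices of index well above k, so that every
   vertex can be exchanged, in boundedly many steps, with any high-degree vertex.
   This gives every r-set a positive proportion of absorbing tuples, and a greedy
   choice with exponential weights finds a small disjoint family containing many
   absorbers of each r-set. *)

Require Import Defs.
From HB Require Import structures.
From mathcomp Require Import all_boot all_order all_algebra.
From mathcomp Require Import reals.
From mathcomp Require Import zify lra.
From mathcomp Require Import boolp.

Set Implicit Arguments.
Unset Strict Implicit.
Unset Printing Implicit Defensive.

(** * Complete multipartite blocks *)

Lemma perm_flatten_cat (T : eqType) (A : Type) (f g : A -> seq T) (s : seq A) :
  perm_eq (flatten [seq f x ++ g x | x <- s])
          (flatten (map f s) ++ flatten (map g s)).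
Proof.
elim: s => [//|x s IH] /=.
by rewrite perm_sym perm_catACA perm_cat2l perm_sym.
Qed.

Lemma perm_flatten_map (T : eqType) (A : Type) (f g : A -> seq T) (s : seq A) :
  (forall x, perm_eq (f x) (g x)) ->
  perm_eq (flatten (map f s)) (flatten (map g s)).
Proof. by move=> fg; elim: s => [//|x s IH] /=; apply: perm_cat. Qed.

Lemma size_flatten_const (T : Type) (ss : seq (seq T)) k :
  all (fun s => size s == k) ss -> size (flatten ss) = k * size ss.
Proof. by elim: ss => [|s ss IH] /=; [lia|case/andP=> /eqP h /IH]; rewrite size_cat; lia. Qed.

Section Blocks.
Variables (T : finType) (e : rel T).

(* A copy of the complete multipartite graph with parts of size [t]; adjacency
   being irreflexive, [pairwise (allrel e)] makes the parts disjoint. *)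
Definition block (t : nat) (b : seq (seq T)) : bool :=
  all (fun P => size P == t) b && pairwise (allrel e) b.

Lemma pairwise_sub (f : seq T -> seq T) (b : seq (seq T)) :
  (forall P, {subset f P <= P}) ->
  pairwise (allrel e) b -> pairwise (allrel e) (map f b).
Proof.
move=> sub; rewrite pairwise_map; apply: sub_pairwise => P Q /= /allrelP h.
by apply/allrelP => x y /sub xP /sub yQ; apply: h.
Qed.

Lemma block_sub (f : seq T -> seq T) t t' b :
  (forall P, {subset f P <= P}) -> (forall P, size P = t -> size (f P) = t') ->
  block t b -> block t' (map f b).
Proof.
move=> sub sz /andP[szb pw]; apply/andP; split; last exact: pairwise_sub.
by rewrite all_map; apply: sub_all szb => P /= /eqP/sz ->.
Qed.

Lemma block_take s t b : s <= t -> block t b -> block s (map (take s) b).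
Proof.
move=> st; apply: block_sub => [P x|P sP]; first exact: mem_take.
by rewrite size_take_min sP; apply/minn_idPl.
Qed.

Lemma block_drop s t b : block t b -> block (t - s) (map (drop s) b).
Proof.
apply: block_sub => [P x|P <-]; first exact: mem_drop.
by rewrite size_drop.
Qed.

Lemma perm_take_drop s (b : seq (seq T)) :
  perm_eq (flatten (map (take s) b) ++ flatten (map (drop s) b)) (flatten b).
Proof.
rewrite perm_sym.
have {1}-> : b = [seq take s P ++ drop s P | P <- b].
  by rewrite -[LHS]map_id; apply: eq_map => P; rewrite cat_take_drop.
exact: perm_flatten_cat.
Qed.

Lemma split_block h t b : block (h * t) b ->
  exists bs, [/\ all (block t) bs, all (fun b' => size b' == size b) bs,
    size bs = h & perm_eq (flatten (flatten bs)) (flatten b)].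
Proof.
elim: h b => [|h IH] b hb.
  exists [::]; split=> //=.
  case/andP: hb => /size_flatten_const sb _.
  by rewrite (size0nil (s := flatten b)) // sb !mul0n.
have hd : block (h * t) (map (drop t) b).
  by rewrite -(addKn t (h * t)) -mulSn; apply: block_drop.
have [bs [b1 b2 b3 b4]] := IH _ hd.
exists (map (take t) b :: bs); split => /=.
- by rewrite b1 andbT; apply: block_take hb; lia.
- by rewrite size_map eqxx /=; move: b2; rewrite size_map.
- by rewrite b3.
- rewrite flatten_cat; apply: perm_trans (perm_take_drop t b).
  by rewrite perm_cat2l.
Qed.

(** The clause on [count] allows any predicate, since later both the bound on the number of parts
    and the number of blocks with fewer than [r] parts must be carried along. *)
Lemma split_blocks h t bs : all (block (h * t)) bs ->
  exists bs', [/\ all (block t) bs', size bs' = h * size bs,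
    (forall a : pred nat, count (a \o size) bs' = h * count (a \o size) bs) &
    perm_eq (flatten (flatten bs')) (flatten (flatten bs))].
Proof.
elim: bs => [_|b bs IH] /=.
  by exists [::]; split => // [|a]; rewrite /= muln0.
case/andP=> /split_block [c [c1 c2 c3 c4]] /IH [c' [d1 d2 d3 d4]].
exists (c ++ c'); split.
- by rewrite all_cat c1.
- by rewrite size_cat c3 d2; lia.
- move=> a; rewrite count_cat d3.
  suff -> : count (a \o size) c = h * a (size b) by lia.
  rewrite -c3; elim: (c) c2 => [//|x s IHs] /= /andP[/eqP -> /IHs ->]; lia.
- by rewrite !flatten_cat; apply: perm_cat.
Qed.

(* With [L] empty and [R] of size [r + 1], this tiles the complete
   [(r + 1)]-partite graph with parts of size [r t] by [r]-partite blocks, each of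
   them skipping one part. In the induction the parts of [L] have already been
   skipped, those of [R] have not. *)
Lemma rotate_block t (L R : seq (seq T)) :
  all (fun P => size P == size R * t) L ->
  all (fun P => size P == (size R).-1 * t) R ->
  pairwise (allrel e) (L ++ R) ->
  exists bs, [/\ all (block t) bs,
    all (fun b => size b == (size L + size R).-1) bs,
    size bs = size R & perm_eq (flatten (flatten bs)) (flatten (L ++ R))].
Proof.
move: {2}(size R) (erefl (size R)) => k; elim: k L R => [|k IH] L [|P R] //=.
  move=> _ /size_flatten_const sL _ _.
  exists [::]; split=> //=; rewrite cats0.
  by rewrite (size0nil (s := flatten L)) // sL !mul0n.
case=> sR aL /andP[sP aR] pw.
(* The new block takes [t] vertices from every part but [P], which joins the skipped parts at full
   size. *)
pose L' := rcons (map (drop t) L) P; pose R' := map (drop t) R.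
have aL' : all (fun Q => size Q == size R' * t) L'.
  rewrite /L' /R' all_rcons size_map sP all_map.
  by apply: sub_all aL => Q /= /eqP; rewrite size_drop; lia.
have aR' : all (fun Q => size Q == (size R').-1 * t) R'.
  rewrite /R' size_map all_map.
  apply: sub_all aR => Q /= /eqP; rewrite size_drop => ->.
  by rewrite -subn1 mulnBl mul1n.
have pw' : pairwise (allrel e) (L' ++ R').
  rewrite /L' /R' cat_rcons.
  move: pw; rewrite !pairwise_cat !allrel_consr !pairwise_cons.
  case/and3P => /andP[h1 h2] h3 /andP[h4 h5].
  have dr Q : {subset drop t Q <= Q} by move=> x; apply: mem_drop.
  apply/and3P; split.
  - apply/andP; split.
      rewrite all_map; apply: sub_all h1 => Q /= /allrelP h.
      by apply/allrelP => x y /dr xQ yP; apply: h.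
    apply/allrelP => Q Q' /mapP[Q0 Q0L ->] /mapP[Q1 Q1L ->].
    apply/allrelP => x y /dr xQ /dr yQ.
    by have /allrelP := h2 => /(_ _ _ Q0L Q1L) /allrelP; apply.
  - exact: pairwise_sub.
  - apply/andP; split; last exact: pairwise_sub.
    rewrite all_map; apply: sub_all h4 => Q /= /allrelP h.
    by apply/allrelP => x y xP /dr yQ; apply: h.
have [|bs [b1 b2 b3 b4]] := IH L' R' _ aL' aR' pw'; first by rewrite size_map.
exists (map (take t) (L ++ R) :: bs); split => /=.
- rewrite b1 andbT; apply/andP; split.
    rewrite all_map all_cat; apply/andP; split.
      apply: sub_all aL => Q /= /eqP sQ; rewrite size_take_min sQ.
      by apply/eqP/minn_idPl; rewrite mulSn leq_addr.
    have [->//|R_gt0] := eqVneq R [::].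
    apply: sub_all aR => Q /= /eqP sQ; rewrite size_take_min sQ.
    apply/eqP/minn_idPl; rewrite -[leqLHS]mul1n leq_mul2r.
    by rewrite lt0n size_eq0 R_gt0 orbT.
  apply: pairwise_sub => [Q x|]; first exact: mem_take.
  move: pw; rewrite !pairwise_cat allrel_consr pairwise_cons.
  by case/and3P => /andP[_ ->] -> /andP[_ ->].
- rewrite size_map size_cat addnS eqxx /=.
  by move: b2; rewrite /L' /R' size_rcons !size_map addSn.
- by rewrite b3 /R' size_map.
- rewrite flatten_cat.
  rewrite (perm_trans (_ : perm_eq _ (flatten (map (take t) (L ++ R)) ++
    flatten (L' ++ R')))) //; first by rewrite perm_cat2l.
  rewrite /L' /R' cat_rcons map_cat !flatten_cat /=.
  rewrite -catA (perm_trans (_ : perm_eq _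
    ((flatten (map (take t) L) ++ flatten (map (drop t) L)) ++
     P ++ (flatten (map (take t) R) ++ flatten (map (drop t) R))))) //.
    rewrite -!catA perm_cat2l perm_catCA perm_cat2l perm_catCA.
    by rewrite perm_cat2l.
  apply: perm_cat; first exact: perm_take_drop.
  by rewrite perm_cat2l; exact: perm_take_drop.
Qed.

End Blocks.

(** * Local improvement of one block *)

Lemma extract_sub (T : eqType) (p : pred T) (A : seq T) k :
  k <= count p A ->
  exists S A', [/\ perm_eq A (S ++ A'), size S = k & all p S].
Proof.
move=> kA; exists (take k (filter p A)), (drop k (filter p A) ++ filter (predC p) A).
split.
- by rewrite catA cat_take_drop perm_sym perm_filterC.
- by rewrite size_take_min size_filter; apply/minn_idPl.
- by apply/allP => x /mem_take; rewrite mem_filter => /andP[].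
Qed.

Lemma count_pigeonhole (T : Type) (C : finType) (f : T -> C) (p : pred T) A k :
  0 < k -> 0 < #|C| -> k * #|C| <= count p A ->
  exists c, k <= count (fun u => p u && (f u == c)) A.
Proof.
move=> k0 C0 kA.
have sumE : count p A = \sum_(c : C) count (fun u => p u && (f u == c)) A.
  elim: A {kA} => [|u A IH] /=; first by rewrite big1.
  rewrite big_split /= -IH; congr (_ + _).
  rewrite (bigD1 (f u)) //= eqxx andbT big1 ?addn0 // => c.
  by rewrite eq_sym => /negbTE ->; rewrite andbF.
case: (pickP (fun c => k <= count (fun u => p u && (f u == c)) A)) => [c ?|no].
  by exists c.
have : count p A <= \sum_(c : C) k.-1.
  by rewrite sumE; apply: leq_sum => c _; have := no c; lia.
rewrite sum_nat_const => /(leq_trans kA).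
by rewrite mulnC leq_pmul2l //; lia.
Qed.

Lemma sum_seq_gap (T : eqType) (w : T -> nat) D (S F : seq T) :
  size S = size F -> (forall u x, u \in S -> x \in F -> w x + D <= w u) ->
  \sum_(x <- F) w x + size S * D <= \sum_(u <- S) w u.
Proof.
elim: S F => [|u S IH] [|x F] //= => [_ _|[sz] h].
  by rewrite !big_nil.
rewrite !big_cons.
have h1 := h u x (mem_head _ _) (mem_head _ _).
have h2 : \sum_(j <- F) w j + size S * D <= \sum_(j <- S) w j.
  by apply: IH => // v y vS yF; apply: h; rewrite inE ?vS ?yF orbT.
lia.
Qed.

Lemma sum_seq_lower (T : eqType) (w : T -> nat) D (S : seq T) :
  (forall u, D <= w u) -> size S * D <= \sum_(u <- S) w u.
Proof.
move=> h; rewrite -sum1_size big_distrl /=.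
by apply: leq_sum => u _; rewrite mul1n.
Qed.

Lemma cost_shift K t h g s : g <= s -> K * t * h + g <= K * (h * t) + s.
Proof. by move=> gs; rewrite mulnAC -mulnA leq_add2l. Qed.

(** Rotation yields one block more than plain splitting, at the price [r * t * (2 * r * m)]; the
    inserted vertices pay it with a surplus of [r * t * m]. *)
Lemma cost_rotate r m t h s D :
  r * t * (2 * r * m + m) <= s -> r * t * D <= r * t * m ->
  r * (2 * r * m) * t * h.+1 + r * t * D <= r * (2 * r * m) * (h * t) + s.
Proof. lia. Qed.

Section Step.
Variables (T : finType) (e : rel T) (kappa : T -> nat) (r m d : nat).

Hypothesis kappa_le : forall x, kappa x <= m.
Hypothesis dm : 8 * d <= m.

(** In [cost], a vertex of a block with [r] parts costs [2rm], one of a smaller block at least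
    [2rm + 2m]. Penalties from [2rm + m] to [2rm + 2m] thus reward both inserting vertices and
    breaking small blocks. *)
Definition pen (x : T) : nat := 2 * r * m + 2 * m - kappa x.

Lemma pen_ge u : 2 * r * m + m <= pen u.
Proof. by rewrite /pen; have := kappa_le u; lia. Qed.

Lemma pen_le u : pen u <= 2 * r * m + 2 * m.
Proof. exact: leq_subr. Qed.

Lemma pen_higher u x : kappa u + 8 * d <= kappa x -> pen x + 8 * d <= pen u.
Proof. by rewrite /pen; have := kappa_le x; have := kappa_le u; lia. Qed.

(* Blocks cost more per vertex the fewer parts they have, and trading an
   uncovered vertex for one with larger [kappa] lowers the cost. *)
Definition cost (t : nat) (bs : seq (seq (seq T))) (U : seq T) : nat :=
  r * (2 * r * m) * t * size bs + \sum_(u <- U) pen u.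

Definition system (t : nat) (bs : seq (seq (seq T))) : bool :=
  all (block e t) bs && all (fun b => 0 < size b <= r) bs.

Definition sees k (u : T) (P : seq T) : bool := k <= count (e u) P.

Definition higher (u x : T) : bool := kappa u + 8 * d <= kappa x.

(* The vertex [u] is adjacent to a large piece of every part of [b], except
   that it may instead replace vertices of much larger [kappa] in one part. *)
Definition useful k (b : seq (seq T)) (u : T) : bool :=
  all (fun P => sees k u P || (k <= count (higher u) P)) b &&
  (count (predC (sees k u)) b <= 1).

(* How a vertex relates to all vertices of [b]; the number of possible values
   depends only on the size of [b]. *)
Definition vtype (b : seq (seq T)) (u : T) :
    (size (flatten b)).-tuple bool * (size (flatten b)).-tuple bool :=
  ([tuple of map (e u) (in_tuple (flatten b))],
   [tuple of map (higher u) (in_tuple (flatten b))]).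

Lemma vtypeP b u v : vtype b u = vtype b v ->
  {in flatten b, e u =1 e v} /\ {in flatten b, higher u =1 higher v}.
Proof.
case=> h1 h2; split.
  by apply/eq_in_map; apply: h1.
by apply/eq_in_map; apply: h2.
Qed.

(** Pigeonhole over the types gives [r * t] useful vertices [S] that relate to [b] in the same way.
    A piece of size [r * t] is cut from each part, the rest of [b] splits into [h - r] blocks, and
    [S] is completely joined to the pieces of the parts it sees. Each of three cases gains at least
    [8 * d] per vertex of [S]. *)
Lemma process_block h t b A : 0 < t -> r <= h ->
  block e (h * t) b -> 0 < size b <= r ->
  r * t * (2 ^ size (flatten b) * 2 ^ size (flatten b)) <=
    count (useful (r * t) b) A ->
  exists S A' bs F, [/\ perm_eq A (S ++ A'), size S = r * t, system t bs,
    perm_eq (flatten (flatten bs) ++ F) (flatten b ++ S) &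
    cost t bs F + r * t * (8 * d) <=
      r * (2 * r * m) * (h * t) + \sum_(u <- S) pen u] /\ size F <= size S.
Proof.
move=> t0 rh hb sb cA.
have r0 : 0 < r by case/andP: sb; apply: leq_trans.
have k0 : 0 < r * t by rewrite muln_gt0 r0.
set k := r * t in k0 cA *.
have [||c kc] := @count_pigeonhole _ _ (vtype b) (useful k b) A k k0.
- by rewrite card_prod !card_tuple card_bool muln_gt0 !expn_gt0.
- by rewrite card_prod !card_tuple card_bool.
have [S [A' [pA sS aS]]] := extract_sub kc.
clear cA kc.
have [u0 u0S] : exists u0, u0 \in S.
  by case: (S) sS => [s0|u0 S0 _]; [rewrite -s0 in k0 | exists u0; apply: mem_head].
have /andP[/andP[use0 cnt0] /eqP tu0] : useful k b u0 && (vtype b u0 == c).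
  exact: (allP aS).
have adjS u x : u \in S -> x \in flatten b -> e u x = e u0 x.
  move=> /(allP aS) /andP[_ /eqP tu] xb.
  by case: (vtypeP (etrans tu (esym tu0))) => h1 _; apply: h1.
have higS u x : u \in S -> x \in flatten b -> higher u x = higher u0 x.
  move=> /(allP aS) /andP[_ /eqP tu] xb.
  by case: (vtypeP (etrans tu (esym tu0))) => _ h1; apply: h1.
(* The vertices to cut from a part: neighbours of [S] if the part is seen, otherwise vertices of
   much larger [kappa], to be released. *)
pose a P := if sees k u0 P then e u0 else higher u0.
pose f (P : seq T) := take k (filter (a P) P).
pose g (P : seq T) := drop k (filter (a P) P) ++ filter (predC (a P)) P.
have fg P : perm_eq P (f P ++ g P).
  by rewrite /f /g catA cat_take_drop perm_sym perm_filterC.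
have ka P : P \in b -> k <= count (a P) P.
  move=> Pb; have := allP use0 _ Pb; rewrite /a.
  by case: ifP => [|_] //=; rewrite /sees.
have sf P : P \in b -> size (f P) = k.
  by move=> Pb; rewrite size_take_min size_filter; apply/minn_idPl/ka.
have fsub P : {subset f P <= P}.
  by move=> x /mem_take; rewrite mem_filter => /andP[].
have fa P x : x \in f P -> a P x.
  by move=> /mem_take; rewrite mem_filter => /andP[].
have gsub P : {subset g P <= P}.
  by move=> x xg; rewrite (perm_mem (fg P)) mem_cat xg orbT.
have /andP[szb pwb] := hb.
have sg P : P \in b -> size (g P) = h * t - k.
  move=> Pb; have /perm_size := fg P; rewrite size_cat sf //.
  by rewrite (eqP (allP szb _ Pb)) => ->; rewrite addKn.
have hg : block e ((h - r) * t) (map g b).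
  apply/andP; split; last exact: pairwise_sub.
  by rewrite mulnBl all_map; apply/allP => P Pb /=; rewrite sg.
have [bs2 [c1 c2 c3 c4]] := split_block hg.
have sys2 : system t bs2.
  rewrite /system c1 /=; apply: sub_all c2 => b' /eqP ->.
  by rewrite size_map.
have inb P x : P \in b -> x \in P -> x \in flatten b.
  by move=> Pb xP; apply/flattenP; exists P.
have pb : perm_eq (flatten (map f b) ++ flatten (map g b)) (flatten b).
  rewrite perm_sym -[in X in perm_eq X _](map_id b).
  exact: perm_trans (perm_flatten_map _ fg) (perm_flatten_cat _ _ _).
have front b' : {subset b' <= b} -> pairwise (allrel e) b' ->
    all (sees k u0) b' -> block e k (S :: map f b').
  move=> sub pw sees'; rewrite /block /= sS eqxx /=; apply/andP; split.
    by rewrite all_map; apply/allP => P /sub Pb /=; rewrite sf.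
  rewrite pairwise_sub // andbT all_map; apply/allP => P Pb' /=.
  apply/allrelP => u x uS xf.
  rewrite adjS //; last exact: inb (sub _ Pb') (fsub _ _ xf).
  by have := fa _ _ xf; rewrite /a (allP sees' _ Pb').
have penS : k * m <= \sum_(u <- S) pen u.
  rewrite -sS; apply: sum_seq_lower => u.
  exact: leq_trans (leq_addl _ _) (pen_ge u).
have penS2 : k * (8 * d) <= \sum_(u <- S) pen u.
  by apply: leq_trans penS; rewrite leq_mul2l dm orbT.
case full : (all (sees k u0) b).
  have fb := front b (fun _ => id) pwb full.
  have [sb_r|sb_r] := eqVneq (size b) r.
    (* With [r] parts in [b], the pieces and [S] form a complete [(r + 1)]-partite graph, which
       rotates into [r + 1] blocks. *)
    have [|||bs1 [b1 b2 b3 b4]] := rotate_block (e := e) (t := t) (L := [::]) (R := S :: map f b).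
    - by [].
    - by case/andP: fb; rewrite /= size_map sb_r.
    - by case/andP: fb.
    exists S, A', (bs1 ++ bs2), [::]; split => //; split => //.
    + case/andP: sys2 => s1 s2; rewrite /system !all_cat b1 s1 s2 /= andbT.
      by apply: sub_all b2 => b' /eqP ->; rewrite /= size_map sb_r r0 leqnn.
    + rewrite cats0 !flatten_cat.
      rewrite (perm_trans (perm_cat b4 c4)) //= -catA perm_catC perm_cat2r.
      exact: pb.
    + rewrite /cost big_nil addn0 size_cat b3 c3 /= size_map sb_r.
      rewrite addSn (subnKC rh).
      apply: cost_rotate; last by rewrite leq_mul2l dm orbT.
      by rewrite -/k -sS; apply: sum_seq_lower; apply: pen_ge.
  (* With fewer than [r] parts, [S] becomes a new part: there are as many blocks as after plain
     splitting, and nothing is released. *)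
  have [bs1 [b1 b2 b3 b4]] := split_block fb.
  exists S, A', (bs1 ++ bs2), [::]; split => //; split => //.
  + case/andP: sys2 => s1 s2; rewrite /system !all_cat b1 s1 s2 /= andbT.
    apply: sub_all b2 => b' /eqP ->; rewrite /= size_map.
    by move: sb sb_r; clear; lia.
  + rewrite cats0 !flatten_cat.
    rewrite (perm_trans (perm_cat b4 c4)) //= -catA perm_catC perm_cat2r.
    exact: pb.
  + rewrite /cost big_nil addn0 size_cat b3 c3 (subnKC rh).
    exact: (cost_shift _ _ _ penS2).
(* With one unseen part, [S] replaces its piece, whose released vertices have [kappa] larger by at
   least [8 * d]. *)
pose b1 := filter (sees k u0) b; pose b2 := filter (predC (sees k u0)) b.
have sb2 : size b2 = 1.
  rewrite size_filter; apply/eqP; rewrite eqn_leq cnt0 /=.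
  by rewrite -has_count has_predC full.
have sb1 : (size b1).+1 = size b.
  by rewrite -(count_predC (sees k u0) b) -!size_filter -/b1 -/b2 sb2 addn1.
have b1sub : {subset b1 <= b} by move=> P; rewrite mem_filter => /andP[].
have fb : block e k (S :: map f b1).
  apply: front => //; last exact: filter_all.
  exact: subseq_pairwise (filter_subseq _ _) pwb.
have [bs1 [d1 d2 d3 d4]] := split_block fb.
pose F := flatten (map f b2).
have sF : size F = k.
  rewrite (@size_flatten_const _ _ k) ?size_map ?sb2 ?muln1 //.
  rewrite all_map; apply/allP => P; rewrite mem_filter => /andP[_ Pb] /=.
  by rewrite sf.
exists S, A', (bs1 ++ bs2), F; split; last by rewrite sF sS.
split => //.
+ case/andP: sys2 => s1 s2; rewrite /system !all_cat d1 s1 s2 /= andbT.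
  apply: sub_all d2 => b' /eqP ->; rewrite /= size_map.
  by move: sb sb1; clear; lia.
+ rewrite !flatten_cat.
  have pf : perm_eq (flatten (map f b1) ++ F) (flatten (map f b)).
    by rewrite /F -flatten_cat -map_cat; apply/perm_flatten/perm_map; rewrite perm_filterC.
  rewrite (perm_trans (_ : perm_eq _ ((S ++ flatten (map f b1)) ++ flatten (map g b) ++ F))) //.
    by rewrite catA perm_cat2r; apply: perm_cat.
  rewrite perm_sym (perm_trans (_ : perm_eq _ (S ++ flatten b))) // -?catA.
    by rewrite perm_catC.
  rewrite perm_cat2l perm_sym.
  rewrite [X in perm_eq X _](_ : _ = flatten (map f b1) ++ (flatten (map g b) ++ F)) //.
  rewrite (perm_trans (_ : perm_eq _ ((flatten (map f b1) ++ F) ++ flatten (map g b)))) //.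
    by rewrite -catA perm_cat2l perm_catC.
  by apply: perm_trans pb; rewrite perm_cat2r.
+ rewrite /cost size_cat d3 c3 (subnKC rh).
  have gap : \sum_(x <- F) pen x + k * (8 * d) <= \sum_(u <- S) pen u.
    rewrite -sS; apply: sum_seq_gap => [|u x uS /flattenP[_ /mapP[P Pb2 ->] xf]].
      by rewrite sS sF.
    move: Pb2; rewrite mem_filter /= => /andP[ns Pb].
    have := fa _ _ xf; rewrite /a (negbTE ns).
    rewrite -(higS u) //; last exact: inb Pb (fsub _ _ xf).
    exact: pen_higher.
  rewrite -addnA; exact: (cost_shift _ _ _ gap).
Qed.

End Step.

(** * Improving many blocks at once *)

Lemma count_flatten_sum (T : Type) (a : pred T) (ss : seq (seq T)) :
  count a (flatten ss) = \sum_(s <- ss) count a s.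
Proof. by elim: ss => [|s ss IH]; rewrite ?big_nil ?big_cons //= count_cat IH. Qed.

Lemma sum_count_exchange (A B : Type) (f : A -> B -> bool) (s : seq A) (t : seq B) :
  \sum_(x <- s) count (f x) t = \sum_(y <- t) count (f^~ y) s.
Proof.
under eq_bigr do rewrite -sum1_count big_mkcond.
under [RHS]eq_bigr do rewrite -sum1_count big_mkcond.
exact: exchange_big.
Qed.

Lemma size_le_sum2 (A : Type) (f : A -> nat) (s : seq A) :
  2 * size s <=
  \sum_(x <- s) f x + 2 * count (fun x => f x == 0) s + count (fun x => f x == 1) s.
Proof.
elim: s => [|x s IH]; rewrite ?big_nil ?big_cons //=.
by case: (f x) => [|[|k]] /=; lia.
Qed.

Lemma size_le_sum1 (A : Type) (f : A -> nat) (s : seq A) :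
  size s <= \sum_(x <- s) f x + count (fun x => f x == 0) s.
Proof.
elim: s => [|x s IH]; rewrite ?big_nil ?big_cons //=.
by case: (f x) => [|k] /=; lia.
Qed.

Lemma sum_threshold (A : Type) (f : A -> nat) X M (s : seq A) :
  (forall x, f x <= M) ->
  \sum_(x <- s) f x <= M * count (fun x => X <= f x) s + X * size s.
Proof.
move=> fM; elim: s => [|x s IH]; rewrite ?big_nil ?big_cons //=.
by have := fM x; case: leqP => /=; lia.
Qed.

Lemma size_flatten_bounds (A : Type) (k : nat) (ss : seq (seq A)) :
  all (fun s => 0 < size s <= k) ss ->
  size ss <= size (flatten ss) <= k * size ss.
Proof.
elim: ss => [|s ss IH] /=; first by rewrite muln0.
by case/andP=> h /IH; rewrite size_cat; lia.
Qed.

(** Both quotients are positive, so each rounding loses at most a factor 2. *)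
Lemma selection_gain d s k : 0 < s -> 0 < k -> 4 * k <= d %/ (2 * s) ->
  d * d <= 2 * s * ((d %/ (2 * s)) %/ (2 * k) * (k * (8 * d))).
Proof.
move=> s0 k0; set X := d %/ _; set n := X %/ _ => kX.
have f1 : X <= n * (2 * k) + 2 * k.
  by rewrite {1}(divn_eq X (2 * k)) leq_add2l ltnW // ltn_pmod // muln_gt0.
have f2 : d <= X * (2 * s) + 2 * s.
  by rewrite {1}(divn_eq d (2 * s)) leq_add2l ltnW // ltn_pmod // muln_gt0.
clearbody X n.
have f3 : d <= 4 * s * X by nia.
have f4 : X <= 4 * (k * n) by nia.
have f5 : 4 * s * X <= 4 * s * (4 * (k * n)) by rewrite leq_mul2l f4 orbT.
rewrite (_ : 2 * s * _ = (16 * (s * (k * n))) * d); last by lia.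
rewrite leq_mul2r; apply/orP; right; lia.
Qed.

Lemma card_set_count (T : finType) (a : pred T) :
  #|[set x | a x]| = count a (enum T).
Proof.
rewrite -size_filter cardE; apply/perm_size/uniq_perm.
- exact: enum_uniq.
- by rewrite filter_uniq ?enum_uniq.
- by move=> x; rewrite [RHS]mem_filter !mem_enum inE andbT.
Qed.

Section Many.
Variables (T : finType) (e : rel T) (kappa : T -> nat) (q r m d : nat).
Hypothesis rE : r = q.+2.
Local Notation sees := (sees e).
Local Notation useful := (useful e kappa d).
Local Notation higher := (higher kappa d).
Local Notation system := (system e r).

Hypothesis cardT : #|T| = r * m.
Hypothesis kappa_le : forall x, kappa x <= m.
Hypothesis deg_kappa : forall x, q * m + 16 * d + kappa x <= #|[set y | e x y]|.
Hypothesis kappa_few : forall i, i <= m -> #|[set x | kappa x < i]| <= i.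

(** Unseen parts contain few neighbours, so the degree of [u] bounds their total size by about
    [2m - kappa u - 16d], while there are at least about [m / t] blocks. Hence either blocks without
    unseen part abound, or the unseen parts of blocks with exactly one contain at least
    [kappa u + 12d] vertices. At most [kappa u + 8d] of these fail to be [higher], and parts with
    fewer than [k] higher vertices lose at most [d] in all. *)
Lemma useful_many t k (bs : seq (seq (seq T))) (U : seq T) u :
  perm_eq (flatten (flatten bs) ++ U) (enum T) -> system t bs ->
  size U <= d -> k * size (flatten bs) <= d ->
  d <= t * count (fun b => useful k b u) bs.
Proof.
move=> pT /andP[blk szs] Ud kJ.
set J := size (flatten bs) in kJ *.
pose uns b := count (predC (sees k u)) b.
pose N := \sum_(b <- bs) uns b.
pose F := count (fun b => uns b == 0) bs.
pose W := count (fun b => uns b == 1) bs.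
have degE : #|[set y | e u y]| = count (e u) (flatten (flatten bs)) + count (e u) U.
  by rewrite -count_cat (permP pT) card_set_count.
have partsz : all (fun P => size P == t) (flatten bs).
  apply/allP => P /flattenP[b bin Pb].
  by have /andP[/allP h _] := allP blk _ bin; apply: h.
have szJ : size (flatten (flatten bs)) = t * J by exact: size_flatten_const.
have sumU : t * J + size U = r * m.
  by rewrite -szJ -size_cat (perm_size pT) -cardE.
have h1 : count (e u) (flatten (flatten bs)) + t * N <= (t + k) * J.
  have -> : N = count (predC (sees k u)) (flatten bs) by rewrite count_flatten_sum.
  rewrite /J; elim: (flatten bs) partsz => [|P PP IH] /=; first by lia.
  case/andP=> /eqP sP /IH; rewrite count_cat.
  have := count_size (e u) P; rewrite /sees; case: leqP => /=; nia.
have h2 : 2 * size bs <= N + 2 * F + W by exact: size_le_sum2.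
have h3 : size bs <= N + F by exact: size_le_sum1.
have /andP[h5 h4] : size bs <= J <= r * size bs by exact: size_flatten_bounds.
have hdeg := deg_kappa u.
have hU := count_size (e u) U.
have FG : F <= count (fun b => useful k b u) bs.
  apply: sub_count => b /eqP uns0; rewrite /useful -/(uns b) uns0 andbT.
  have : all (sees k u) b.
    by apply: contra_eqT uns0; rewrite -has_predC has_count -lt0n.
  by apply: sub_all => P ->.
have [tF|tF] := leqP d (t * F).
  by apply: leq_trans tF _; rewrite leq_mul2l FG orbT.
have e1 : q * m + 16 * d + kappa u + t * N <= r * m + d.
  move: h1 hU Ud kJ sumU hdeg; rewrite degE mulnDl.
  move: (size U) (count (e u) U) (count _ _) => a1 a2 a3; clear; lia.
have e2 : r * m <= r * (t * size bs) + d.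
  by rewrite -sumU leq_add // mulnCA leq_mul2l h4 orbT.
have e3 : 2 * m <= 2 * (t * size bs) + d by rewrite rE in e2 *; nia.
have e4 : 2 * (t * size bs) <= t * N + 2 * (t * F) + t * W.
  have : t * (2 * size bs) <= t * (N + 2 * F + W) by rewrite leq_mul2l h2 orbT.
  lia.
have e5 : t * size bs <= t * N + t * F.
  by rewrite -mulnDr leq_mul2l h3 orbT.
have e6 : kappa u + 12 * d <= t * W by rewrite rE in e1; lia.
(* This admits the level [kappa u + 8 * d] in [kappa_few]. *)
have e7 : kappa u + 8 * d <= m by rewrite rE in e1; lia.
pose ub b := filter (predC (sees k u)) b.
pose bs1 := filter (fun b => uns b == 1) bs.
pose VV := flatten (flatten (map ub bs1)).
have sV : size VV = t * W.
  rewrite /VV (@size_flatten_const _ _ t).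
    rewrite (@size_flatten_const _ _ 1) ?size_map ?size_filter ?mul1n //.
    rewrite all_map; apply/allP => b; rewrite mem_filter => /andP[/eqP ub1 _].
    by rewrite /= /ub size_filter -/(uns b) ub1.
  apply/allP => P /flattenP[_ /mapP[b bin ->]]; rewrite mem_filter => /andP[_ Pb].
  apply: (allP partsz); apply/flattenP; exists b => //.
  by move: bin; rewrite mem_filter => /andP[].
have sub1 : subseq VV (flatten (flatten bs)).
  rewrite /VV /bs1; elim: (bs) => [//|b bs' IH] /=.
  case: ifP => _ /=; rewrite !flatten_cat.
    apply: cat_subseq IH; rewrite /ub.
    elim: (b) => [//|P b' IHb] /=; case: ifP => _ /=.
      exact: cat_subseq (subseq_refl _) IHb.
    exact: subseq_trans IHb (suffix_subseq _ _).
  exact: subseq_trans IH (suffix_subseq _ _).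
have uV : uniq VV.
  apply: subseq_uniq sub1 _.
  have := enum_uniq T; rewrite -(perm_uniq pT) cat_uniq.
  by case/andP.
have hV : 4 * d <= count (higher u) VV.
  have : count (predC (higher u)) VV <= kappa u + 8 * d.
    apply: leq_trans (kappa_few e7).
    rewrite -size_filter -(card_uniqP (filter_uniq _ uV)).
    apply: subset_leq_card; apply/subsetP => x; rewrite mem_filter !inE.
    by rewrite /higher /= -ltnNge => /andP[].
  have := count_predC (higher u) VV; lia.
have hG : count (higher u) VV <=
    t * count (fun b => useful k b u) bs + k * size bs.
  rewrite /VV /bs1; elim: (bs) blk => [//|b bs' IH] /= /andP[/andP[szb _] /IH {}IH].
  case: ifP => ub1 /=; last by lia.
  rewrite flatten_cat count_cat.
  suff : count (higher u) (flatten (ub b)) <= t * useful k b u + k by lia.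
  have : size (ub b) = 1 by rewrite size_filter -/(uns b) (eqP ub1).
  case Eub: (ub b) => [|P []] //= _; rewrite cats0.
  have : P \in ub b by rewrite Eub mem_head.
  rewrite mem_filter => /andP[nP Pb].
  have cP := count_size (higher u) P; rewrite (eqP (allP szb _ Pb)) in cP.
  have [kP|] := leqP k (count (higher u) P); last first.
    by move/ltnW=> kP; rewrite (leq_trans kP) ?leq_addl.
  suff -> : useful k b u by rewrite muln1 (leq_trans cP) ?leq_addr.
  rewrite /useful -/(uns b) (eqP ub1) andbT; apply/allP => Q Qb.
  case sQ : (sees k u Q) => //=.
  have : Q \in ub b by rewrite mem_filter /= sQ.
  by rewrite Eub inE => /eqP ->.
have : k * size bs <= d by apply: leq_trans kJ; rewrite leq_mul2l h5 orbT.
lia.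
Qed.

Hypothesis dm : 8 * d <= m.
Local Notation cost := (cost kappa r m).
Local Notation pen := (pen kappa r m).

Lemma process_list h t bs A : 0 < t -> r <= h ->
  system (h * t) bs ->
  (forall b, b \in bs -> r * t * 4 ^ (r * (h * t)) + r * t * size bs <=
      count (useful (r * t) b) A) ->
  exists bs' F A', [/\ system t bs',
    perm_eq (flatten (flatten bs') ++ F ++ A') (flatten (flatten bs) ++ A),
    cost t bs' (F ++ A') + size bs * (r * t * (8 * d)) <= cost (h * t) bs A &
    size (F ++ A') <= size A].
Proof.
move=> t0 rh; elim: bs A => [|b bs IH] A.
  move=> _ _; exists [::], [::], A; split => //.
  by rewrite /cost /= mul0n addn0 !muln0.
rewrite /system /= => /andP[/andP[hb hbs] /andP[sb sbs]] many.
have [|S [A1 [b1 [F1 [[p1 s1 sys1 p2 c1] sF]]]]] :=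
    process_block (e := e) (A := A) kappa_le dm t0 rh hb sb.
  apply: leq_trans (many b (mem_head _ _)).
  rewrite -expnMn (_ : 2 * 2 = 4) // -[X in X <= _]addn0 leq_add //.
  rewrite leq_mul2l; apply/orP; right; rewrite leq_exp2l //.
  have /andP[szb _] := hb.
  rewrite (size_flatten_const szb) mulnC leq_mul2r.
  by case/andP: sb => _ ->; rewrite orbT.
have [|b' bin|b2 [F2 [A2 [sys2 p3 c2 sF2]]]] := IH A1.
- by rewrite /system hbs.
- have := many b'; rewrite inE bin orbT => /(_ isT).
  have /permP/(_ (useful (r * t) b')) := p1; rewrite count_cat.
  have := count_size (useful (r * t) b') S; rewrite s1 /=; lia.
exists (b1 ++ b2), (F1 ++ F2), A2; split.
- by move: sys1 sys2; rewrite /system !all_cat => /andP[-> ->] /andP[-> ->].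
- rewrite !flatten_cat.
  rewrite (perm_trans (_ : perm_eq _ ((flatten (flatten b1) ++ F1) ++
    (flatten (flatten b2) ++ F2 ++ A2)))) //.
    by rewrite -!catA perm_cat2l perm_catCA.
  rewrite (perm_trans (perm_cat p2 p3)) //.
  rewrite -!catA perm_cat2l perm_catCA perm_cat2l perm_sym.
  exact: p1.
- move: c1 c2; rewrite /cost !big_cat size_cat /=.
  rewrite (perm_big _ p1) big_cat /=; lia.
- by rewrite (perm_size p1) -catA size_cat [in leqRHS]size_cat leq_add.
Qed.

Lemma size_flatten_system t bs U :
  perm_eq (flatten (flatten bs) ++ U) (enum T) -> system t bs ->
  t * size (flatten bs) + size U = r * m.
Proof.
move=> pT /andP[blk _].
rewrite -(@size_flatten_const _ (flatten bs)); last first.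
  apply/allP => P /flattenP[b bin Pb].
  by have /andP[/allP h _] := allP blk _ bin; apply: h.
by rewrite -size_cat (perm_size pT) -cardE.
Qed.

(** If many vertices are uncovered, double counting the pairs of a block and a vertex useful for it
    gives many blocks with at least [X] useful vertices. Processing some of them lowers the cost by
    [d ^ 2 / (2 * s)]; the factor [2 * s] avoids the division. *)
Lemma process_system g h t s bs U : 0 < t -> 0 < g -> 0 < s ->
  h = 16 * r * g -> h <= s -> r * m <= 16 * g * d ->
  2 * (r * t * 4 ^ (r * (h * t))) <= d %/ (2 * s) ->
  perm_eq (flatten (flatten bs) ++ U) (enum T) -> system (h * t) bs ->
  size U <= d -> r * m <= s * size U ->
  exists bs' U', [/\ perm_eq (flatten (flatten bs') ++ U') (enum T),
    system t bs', size U' <= size U &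
    2 * s * cost t bs' U' + d * d <= 2 * s * cost (h * t) bs U].
Proof.
move=> t0 g0 s0 hE hs nd big pT sys Ud Us.
set kC := r * t * 4 ^ (r * (h * t)) in big.
have kCE : r * t * 4 ^ (r * (h * t)) = kC by [].
set X := d %/ (2 * s) in big; pose k := r * t.
have sJ := size_flatten_system pT sys.
have szbs : size bs <= size (flatten bs).
  by case/andP: sys => _ /size_flatten_bounds /andP[].
have um0 u : r * t * size (flatten bs) <= d ->
    d <= h * t * count (fun b => useful (r * t) b u) bs.
  exact: useful_many pT sys Ud.
set J := size (flatten bs) in sJ szbs um0; clearbody J.
have k0 : 0 < k by rewrite /k rE muln_gt0 t0.
have X8 : 4 * k <= X.
  apply: leq_trans big; rewrite /kC -/k.
  have -> : 4 ^ (r * (h * t)) = 4 * 4 ^ (r * (h * t)).-1.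
    by rewrite -expnS prednK // !muln_gt0 t0 hE rE !muln_gt0 g0.
  have : 0 < 4 ^ (r * (h * t)).-1 by rewrite expn_gt0.
  by move: (k) (4 ^ _) => a b; clear; nia.
clearbody kC.
(* The factor [h = 16 * r * g] is chosen for this bound. *)
have kJ : k * J <= d.
  have : h * t * J <= 16 * g * d by apply: leq_trans nd; rewrite -sJ leq_addr.
  rewrite hE /k (_ : 16 * r * g * t * J = 16 * g * (r * t * J)); last by lia.
  by rewrite leq_pmul2l; lia.
have um u : d <= h * t * count (fun b => useful k b u) bs.
  exact: um0.
have d_gt0 : 0 < d.
  have : 0 < X by apply: leq_trans X8; rewrite muln_gt0.
  by rewrite /X; case: (d) => //; rewrite div0n.
have U0 : 0 < size U.
  rewrite lt0n; apply/eqP => U0; move: Us dm d_gt0; rewrite U0 rE muln0.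
  by move: (d) (m) q; clear; nia.
(* By the choice of [X], blocks below this threshold account for at most half of the pairs. *)
pose p b := X <= count (useful k b) U.
pose sel := count p bs.
have dc : size U * d <= h * t * \sum_(b <- bs) count (useful k b) U.
  rewrite sum_count_exchange big_distrr /=.
  rewrite -sum1_size big_distrl /=; apply: leq_sum => u _.
  by rewrite mul1n; apply: um.
have dc2 : \sum_(b <- bs) count (useful k b) U <= size U * sel + X * size bs.
  by apply: sum_threshold => b; apply: count_size.
have sX : 2 * s * X <= d by rewrite mulnC leq_divM.
have selbig : d <= 2 * (h * t) * sel.
  rewrite -(leq_pmul2l U0).
  have f1 : size U * d <= h * t * (size U * sel) + X * (r * m).
    apply: leq_trans dc _; apply: leq_trans (leq_mul (leqnn (h * t)) dc2) _.
    rewrite mulnDr leq_add2l mulnCA leq_mul2l; apply/orP; right.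
    by apply: leq_trans (_ : h * t * J <= _); rewrite ?leq_mul2l ?szbs ?orbT // -sJ leq_addr.
  have f2 : 2 * (X * (r * m)) <= size U * d.
    apply: leq_trans (_ : 2 * (X * (s * size U)) <= _).
      by rewrite !leq_mul2l Us !orbT.
    by rewrite [leqLHS](_ : _ = size U * (2 * s * X)) ?leq_mul2l ?sX ?orbT //; lia.
  lia.
(* Processing consumes at most half of the [X] useful vertices of a block; the other half meets the
   pigeonhole bound [kC]. *)
pose nsel := X %/ (2 * k).
have nk : 2 * k * nsel <= X by rewrite mulnC leq_divM.
have nsel_le : nsel <= sel.
  have f1 : 2 * s * (2 * k * nsel) <= 2 * (h * t) * sel.
    apply: leq_trans selbig; apply: leq_trans sX.
    by rewrite leq_mul2l nk orbT.
  have f2 : 2 * (h * t) * nsel <= 2 * s * (2 * k * nsel).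
    rewrite /k (_ : 2 * s * _ = 2 * (s * (2 * r) * t) * nsel); last by lia.
    rewrite leq_mul2r; apply/orP; right; rewrite leq_mul2l /= leq_mul2r.
    by rewrite (leq_trans hs) ?orbT // rE leq_pmulr.
  have h0 : 0 < 2 * (h * t) by rewrite hE !muln_gt0; lia.
  by rewrite -(leq_pmul2l h0); apply: leq_trans f2 f1.
have [bs1 [bs2 [pb sb1 pb1]]] := extract_sub nsel_le.
have /andP[blk szs] := sys.
have sys1 : system (h * t) bs1.
  apply/andP; split; apply/allP => b b1.
    by apply: (allP blk); rewrite (perm_mem pb) mem_cat b1.
  by apply: (allP szs); rewrite (perm_mem pb) mem_cat b1.
have rh : r <= h by rewrite hE mulnAC leq_pmull // muln_gt0.
have [b bin|bs1' [F [A' [sysn pn cn sn]]]] := process_list t0 rh sys1 (A := U).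
- apply: leq_trans (allP pb1 _ bin); rewrite sb1 kCE -/k.
  move: big nk; rewrite -mulnA.
  by move: (kC) (X) (k * nsel); clear; lia.
have [|bs2' [e1 e2 e3 e4]] := @split_blocks _ e h t bs2.
  by apply/allP => b b2; apply: (allP blk); rewrite (perm_mem pb) mem_cat b2 orbT.
exists (bs1' ++ bs2'), (F ++ A'); split => //.
- rewrite (perm_trans _ pT) // !flatten_cat.
  rewrite perm_sym (perm_trans (perm_cat (perm_flatten (perm_flatten pb)) (perm_refl U))) //.
  rewrite !flatten_cat perm_sym -!catA.
  rewrite (perm_trans (_ : perm_eq _ (flatten (flatten bs2') ++
    (flatten (flatten bs1') ++ F ++ A')))) //.
    by rewrite perm_catCA.
  rewrite (perm_trans (perm_cat e4 pn)) // perm_catCA catA.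
  by rewrite ?catA.
- case/andP: sysn => n1 n2; rewrite /system !all_cat n1 n2 e1 /=.
  have := e3 (fun j => ~~ (0 < j <= r)); rewrite /comp.
  have -> : count (fun x => ~~ (0 < size x <= r)) bs2 = 0.
    apply/eqP; rewrite -leqn0 leqNgt -has_count; apply/hasPn => b b2.
    by rewrite negbK; apply: (allP szs); rewrite (perm_mem pb) mem_cat b2 orbT.
  rewrite muln0 => /eqP; rewrite -leqn0 leqNgt -has_count => /hasPn h0.
  by apply/allP => b /h0; rewrite negbK.
- have cc : cost t (bs1' ++ bs2') (F ++ A') + nsel * (k * (8 * d)) <= cost (h * t) bs U.
    move: cn; rewrite /cost size_cat e2 (perm_size pb) size_cat sb1 -/k.
    move: (r * (2 * r * m)) (\sum_(u <- _) _) (\sum_(u <- _) _) (k * _) => a1 a2 a3 a4.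
    by move: (size bs2) (size bs1') (nsel) => a5 a6 a7; clear; lia.
  have := leq_mul (leqnn (2 * s)) cc; rewrite mulnDr; apply: leq_trans.
  by rewrite leq_add2l; apply: selection_gain.
Qed.

End Many.

(** * Almost perfect packings *)

(* The degree condition for [r = q.+2] and [n = r * m], read vertex by vertex:
   [kappa x] stands for the index of [x] in the degree sequence capped at [m]
   (and may exceed it), and [16 * d] is the slack. *)
Record rich (T : finType) (e : rel T) (kappa : T -> nat) (q m d : nat) : Prop :=
  Rich {
    rich_card : #|T| = q.+2 * m;
    rich_kappa : forall x, kappa x <= m;
    rich_deg : forall x, q * m + 16 * d + kappa x <= #|[set y | e x y]|;
    rich_few : forall i, i <= m -> #|[set x | kappa x < i]| <= i;
    rich_small : 8 * d <= m }.

Lemma chunk (T : eqType) (t : nat) (s : seq T) : 0 < t ->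
  exists bs U, [/\ perm_eq (flatten (flatten bs) ++ U) s, size U < t,
    all (fun b => size b == 1) bs & all (fun P => size P == t) (flatten bs)].
Proof.
move=> t0; move: {2}(size s) (leqnn (size s)) => n.
elim: n s => [|n IH] s sn.
  by exists [::], s; split => //=; apply: leq_ltn_trans sn t0.
have [st|ts] := ltnP (size s) t; first by exists [::], s.
have [|bs [U [p1 p2 p3 p4]]] := IH (drop t s).
  by rewrite size_drop leq_subLR (leq_trans sn) // -add1n leq_add2r.
exists ([:: take t s] :: bs), U; split => //=.
  rewrite -catA -[X in perm_eq _ X](cat_take_drop t s) perm_cat2l.
  exact: p1.
by rewrite p4 andbT size_take_min; apply/eqP/minn_idPl.
Qed.

(** * Breaking blocks with too few parts *)

Section Dissolve.
Variables (T : finType) (e : rel T) (kappa : T -> nat) (q r m d : nat).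
Hypothesis rE : r = q.+2.
Hypothesis dm : 8 * d <= m.
Local Notation system := (system e r).
Local Notation cost := (cost kappa r m).

(** The gain is the difference [r' * 2r'm' - (r' - 1) * (2r'm' + 2m') = 2m'], taken [t * y]
    times. *)
Lemma dissolve_cost r' t y m' c p1 p2 : 0 < r' ->
  p1 <= t * (r'.-1 * y) * (2 * r' * m' + 2 * m') ->
  r' * (2 * r' * m') * t * c + (p1 + p2) + 2 * m' * (t * y) <=
  r' * (2 * r' * m') * t * (y + c) + p2.
Proof. by case: r' => // r' _ /=; lia. Qed.

(* A block costs the same whatever its number of parts, so breaking one with fewer
   than [r] parts lowers the cost although it uncovers vertices. *)
Lemma dissolve_system g t s (bs : seq (seq (seq T))) (U : seq T) :
  0 < t -> 0 < s -> 16 * r * g <= s ->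
  r * m <= 16 * g * d ->
  perm_eq (flatten (flatten bs) ++ U) (enum T) -> system t bs ->
  s * size U <= r * m ->
  r * m <= s * t * count (fun b => size b != r) bs -> s * t <= r * m ->
  exists bs' U', [/\ perm_eq (flatten (flatten bs') ++ U') (enum T),
    system t bs', size U' <= d &
    2 * s * cost t bs' U' + d * d <= 2 * s * cost t bs U].
Proof.
move=> t0 s0 hs nd pT sys Us big stn.
have st0 : 0 < s * t by rewrite muln_gt0 s0.
set n := r * m in nd Us big stn *.
(* Breaking [y] blocks uncovers at most [(r - 1) * n / s] vertices; with those of [U] this makes at
   most [r * n / s <= d]. *)
pose y := n %/ (s * t).
have ycount : y <= count (fun b => size b != r) bs.
  by rewrite -ltnS ltn_divLR // mulnC (leq_ltn_trans big) // ltn_pmul2l.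
have sty : s * t * y <= n by rewrite mulnC leq_divM.
have nst : n <= 2 * (s * t * y).
  have f1 : n <= y * (s * t) + s * t.
    by rewrite {1}(divn_eq n (s * t)) leq_add2l ltnW // ltn_pmod.
  have f2 : 0 < y by rewrite divn_gt0.
  by move: f1 f2; move: (s * t) (y) (n) => a b c; clear; nia.
have [D [R [pD sD aD]]] := extract_sub ycount.
have /andP[blk szs] := sys.
have Dbs b : b \in D -> b \in bs by move=> bD; rewrite (perm_mem pD) mem_cat bD.
have Rbs b : b \in R -> b \in bs by move=> bR; rewrite (perm_mem pD) mem_cat bR orbT.
have sfD : size (flatten D) <= q.+1 * y.
  have : all (fun b => 0 < size b <= q.+1) D.
    apply/allP => b bD; have := allP szs _ (Dbs _ bD); have := allP aD _ bD.
    by rewrite rE; move: (size b); clear; lia.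
  by move/size_flatten_bounds/andP; rewrite sD => -[].
have sffD : size (flatten (flatten D)) = t * size (flatten D).
  apply: size_flatten_const; apply/allP => P /flattenP[b bD Pb].
  by have /andP[/allP h _] := allP blk _ (Dbs _ bD); apply: h.
have sffD2 : size (flatten (flatten D)) <= t * (q.+1 * y).
  by rewrite sffD leq_mul2l sfD orbT.
exists R, (flatten (flatten D) ++ U); split.
- rewrite (perm_trans _ pT) // catA perm_cat2r -!flatten_cat.
  do 2!apply: perm_flatten.
  by rewrite perm_catC perm_sym.
- rewrite /system; apply/andP; split; apply/allP => b /Rbs bR.
    exact: (allP blk).
  exact: (allP szs).
- rewrite size_cat -(leq_pmul2l s0) mulnDr.
  have f1 : s * size (flatten (flatten D)) <= q.+1 * n.
    apply: leq_trans (leq_mul (leqnn s) sffD2) _.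
    by rewrite mulnA mulnCA leq_mul2l sty orbT.
  apply: leq_trans (leq_add f1 Us) _.
  rewrite addnC -mulSn -rE.
  apply: leq_trans (leq_mul (leqnn r) nd) _.
  by rewrite !mulnA leq_mul2r (mulnC r) hs orbT.
- have c1 : cost t R (flatten (flatten D) ++ U) + 2 * m * (t * y) <= cost t bs U.
    rewrite /cost big_cat (perm_size pD) size_cat sD /=.
    apply: dissolve_cost; first by rewrite rE.
    rewrite rE /= -rE.
    apply: leq_trans (_ : size (flatten (flatten D)) * (2 * r * m + 2 * m) <= _).
      rewrite -sum1_size big_distrl /=; apply: leq_sum => x _.
      by rewrite mul1n pen_le.
    by rewrite leq_mul2r sffD2 orbT.
  have := leq_mul (leqnn (2 * s)) c1; rewrite mulnDr; apply: leq_trans.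
  rewrite leq_add2l.
  have f3 : d <= m by apply: leq_trans dm; rewrite leq_pmull.
  have f4 : d <= n.
    by apply: leq_trans f3 _; rewrite /n rE leq_pmull.
  apply: leq_trans (leq_mul f3 (leq_trans f4 nst)) _.
  by move: (s) (t) (y) => a b c; clear; nia.
Qed.
End Dissolve.

(** If the first bound fails, blocks can be processed; if only the second fails, blocks can be
    broken. *)
Definition nearly_perfect (T : finType) (q m s t : nat) (bs : seq (seq (seq T)))
    (U : seq T) : bool :=
  (s * size U < q.+2 * m) &&
  (s * t * count (fun b => size b != q.+2) bs < q.+2 * m).

Lemma initial_cost r m t : 1 < r -> t <= m ->
  r * (2 * r * m) * (r * m) + t * (2 * r * m + 2 * m) <= 4 * r ^ 3 * (m * m).
Proof.
move=> r2 tm; have h1 : t * (2 * r * m + 2 * m) <= 4 * r * (m * m).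
  by rewrite (_ : 4 * r * (m * m) = m * (4 * r * m)); [apply: leq_mul; nia | lia].
have h2 : 4 * r <= 2 * (r * r * r).
  by rewrite (_ : 2 * _ = 2 * (r * r) * r) ?leq_mul2r; [apply/orP; right; nia | lia].
have h3 : 4 * r * (m * m) <= 2 * (r * r * r) * (m * m) by rewrite leq_mul2r h2 orbT.
rewrite !expnS expn0; lia.
Qed.

(** Induction on the number [N] of rounds, for all final part sizes [t]: a round divides the part
    size by [h], so the earlier rounds must end at [h * t]. A round lowers the cost by at least
    [d ^ 2 / (2 * s)], unless both bounds hold already and the blocks are merely split. *)
Lemma improve_system (q g s : nat) : 0 < g -> 16 * q.+2 * g <= s ->
  forall N t, 0 < t -> exists m0, forall (T : finType) (e : rel T) kappa m d,
    m0 <= m -> rich e kappa q m d -> q.+2 * m <= 16 * g * d ->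
    exists (bs : seq (seq (seq T))) (U : seq T),
      [/\ perm_eq (flatten (flatten bs) ++ U) (enum T),
        system e q.+2 t bs, size U <= d &
        nearly_perfect q m s t bs U \/
        2 * s * cost kappa q.+2 m t bs U + N * (d * d) <=
          2 * s * (4 * q.+2 ^ 3 * (m * m))].
Proof.
move=> g0 hs; have [r rE] : {r | r = q.+2} by exists q.+2.
rewrite -rE in hs *.
have r0 : 0 < r by rewrite rE.
have r2 : 1 < r by rewrite rE.
have s0 : 0 < s by apply: leq_trans hs; rewrite !muln_gt0 r0.
have from_m B m d : 16 * g * B <= m -> r * m <= 16 * g * d -> B <= d.
  move=> h1 h2; have : 16 * g * B <= 16 * g * d.
    by apply: leq_trans h2; apply: leq_trans h1 _; rewrite leq_pmull.
  by rewrite leq_pmul2l // muln_gt0.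
elim=> [|N IH] t t0.
  exists (16 * g * t) => T e kappa m d m0 hr nd.
  have td : t <= d := from_m _ _ _ m0 nd.
  (* The initial blocks have a single part, so that any vertices will do. *)
  have [bs [U [p1 p2 p3 p4]]] := chunk (enum T) t0.
  exists bs, U; split => //.
  - apply/andP; split; apply/allP => b bin; last first.
      by rewrite (eqP (allP p3 _ bin)) rE.
    apply/andP; split.
      by apply/allP => P Pb; apply: (allP p4); apply/flattenP; exists b.
    have := allP p3 _ bin; case: (b) => [|P []] //=.
  - exact: leq_trans (ltnW p2) td.
  right; rewrite mul0n addn0 leq_mul2l; apply/orP; right.
  have sb : t * size bs <= r * m.
    have e1 : size (flatten bs) = size bs.
      by rewrite (@size_flatten_const _ _ 1) ?mul1n.
    rewrite -e1 -(size_flatten_const p4) (_ : r * m = #|T|).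
      by rewrite cardE -(perm_size p1) size_cat leq_addr.
    by rewrite (rich_card hr) rE.
  have f1 : \sum_(u <- U) pen kappa r m u <= t * (2 * r * m + 2 * m).
    apply: leq_trans (_ : size U * (2 * r * m + 2 * m) <= _).
      rewrite -sum1_size big_distrl /=; apply: leq_sum => x _.
      by rewrite mul1n pen_le.
    by rewrite leq_mul2r ltnW ?orbT.
  have tm : t <= m.
    by apply: leq_trans m0; rewrite leq_pmull // muln_gt0.
  rewrite /cost -mulnA; apply: leq_trans (leq_add (leq_mul (leqnn _) sb) f1) _.
  exact: initial_cost.
pose h := 16 * r * g.
have h0 : 0 < h by rewrite !muln_gt0 r0.
have [|m1 Hm1] := IH (h * t); first by rewrite muln_gt0 h0.
pose B := 2 * s * (2 * (r * t * 4 ^ (r * (h * t)))).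
exists (m1 + (16 * g * B + s * (h * t))) => T e kappa m d mbig hr nd.
have [|bs [U [p1 p2 p3 p4]]] := Hm1 T e kappa m d _ hr nd.
  by apply: leq_trans mbig; rewrite leq_addr.
have [cT k1 k2 k3 dm] := hr.
have cT' : #|T| = r * m by rewrite rE.
have splitting (bs1 : seq (seq (seq T))) (U1 : seq T) :
    perm_eq (flatten (flatten bs1) ++ U1) (enum T) -> system e r (h * t) bs1 ->
    exists bs2, [/\ perm_eq (flatten (flatten bs2) ++ U1) (enum T),
      system e r t bs2, t * size bs2 = h * t * size bs1 &
      t * count (fun b => size b != r) bs2 =
      h * t * count (fun b => size b != r) bs1].
  move=> pT /andP[/split_blocks[bs2 [b1 b2 b3 b4]] szs]; exists bs2; split.
  - by rewrite (perm_trans _ pT) // perm_cat2r.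
  - rewrite /system b1 /=.
    have := b3 (fun j => ~~ (0 < j <= r)); rewrite /comp.
    have -> : count (fun x => ~~ (0 < size x <= r)) bs1 = 0.
      apply/eqP; rewrite -leqn0 leqNgt -has_count; apply/hasPn => b b2'.
      by rewrite negbK; apply: (allP szs).
    rewrite muln0 => /eqP; rewrite -leqn0 leqNgt -has_count => /hasPn hh.
    by apply/allP => b /hh; rewrite negbK.
  - by rewrite b2 mulnCA mulnA.
  - by rewrite (b3 (fun j => j != r)) mulnCA mulnA.
case nr : (nearly_perfect q m s (h * t) bs U).
  have [bs2 [c1 c2 c3 c4]] := splitting _ _ p1 p2.
  exists bs2, U; split => //; left.
  move: nr; rewrite /nearly_perfect -rE => /andP[-> h2].
  by rewrite -mulnA c4 mulnA.
case: p4 => [|p4]; first by rewrite nr.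
suff [bs' [U' [c1 c2 c3 c4]]] : exists bs' U',
    [/\ perm_eq (flatten (flatten bs') ++ U') (enum T),
    system e r t bs', size U' <= d &
    2 * s * cost kappa r m t bs' U' + d * d <= 2 * s * cost kappa r m (h * t) bs U].
  exists bs', U'; split => //; right.
  by rewrite mulSn addnA (leq_trans _ p4) // leq_add2r.
have [Us|Us] := leqP (r * m) (s * size U).
  have [|bs' [U' [c1 c2 c3 c4]]] := process_system rE cT' k1 k2 k3 dm t0 g0 s0
    (erefl h) hs nd _ p1 p2 p3 Us.
    rewrite leq_divRL ?muln_gt0 ?s0 // mulnC.
    apply: (from_m _ _ _ _ nd); apply: leq_trans mbig.
    by rewrite addnCA leq_addr.
  by exists bs', U'; split => //; apply: leq_trans c3 p3.
have [|||bs' [U' [c1 c2 c3 c4]]] := dissolve_system kappa rE dm _ s0 hs nd p1 p2 (ltnW Us).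
- by rewrite muln_gt0 h0.
- by move: nr; rewrite /nearly_perfect -rE Us /= => /negbT; rewrite -leqNgt.
- by apply: leq_trans (_ : m <= _); rewrite ?leq_pmull // (leq_trans _ mbig) // addnA leq_addl.
(* Breaking leaves parts of size [h * t]; splitting reduces them to [t] at equal cost. *)
have [bs2 [d1 d2 d3 d4]] := splitting _ _ c1 c2.
exists bs2, U'; split => //.
by move: c4; rewrite /cost -!(mulnA (r * (2 * r * m))) d3.
Qed.

Lemma block1_pairwise (T : finType) (e : rel T) b :
  block e 1 b -> size (flatten b) = size b /\ pairwise e (flatten b).
Proof.
elim: b => [//|P b IH] /andP[/= /andP[/eqP sP szb] /andP[eP pw]].
have [|sb pwb] := IH; first by rewrite /block szb.
move: sP eP; case: P => [//|x [|//]] _ eP; split; rewrite /= ?sb //.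
rewrite pwb andbT; apply/allP => y /flattenP[Q Qb yQ].
by have := allP eP _ Qb; rewrite /= => /andP[/allP h _]; apply: h.
Qed.

(** As [m <= 16 * g * d], the scaled initial cost is at most [N * d ^ 2], so [N.+1] rounds cannot
    all lower it. The rounds end with parts of size 1: blocks with [r] parts are cliques, the others
    are given up. *)
Lemma near_perfect (q g s : nat) : 0 < g -> 0 < s ->
  exists m0, forall (T : finType) (e : rel T) kappa m d,
    m0 <= m -> rich e kappa q m d -> q.+2 * m <= 16 * g * d ->
    exists cs U, [/\ perm_eq (flatten cs ++ U) (enum T),
      all (fun c => (size c == q.+2) && pairwise e c) cs &
      s * size U <= q.+2 * m].
Proof.
(* The given up blocks and [U] have at most [(r + 1) * n / s1] vertices together; the last factor
   serves [improve_system]. *)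
move=> g0 s0; pose s1 := q.+3 * s * (16 * q.+2 * g).
have hs1 : 16 * q.+2 * g <= s1 by rewrite leq_pmull // muln_gt0.
pose N := 2 * s1 * (4 * q.+2 ^ 3 * (256 * (g * g))).
have [m0 Hm0] := improve_system g0 hs1 N.+1 (ltnSn 0).
exists m0.+1 => T e kappa m d mm hr nd.
have [bs [U [p1 p2 p3 p4]]] := Hm0 T e kappa m d (ltnW mm) hr nd.
have {p4} /andP[n1 n2] : nearly_perfect q m s1 1 bs U.
  case: p4 => // p4; exfalso.
  have d0 : 0 < d.
    by rewrite lt0n; apply/eqP => d0; move: nd mm; rewrite d0 muln0; case: (m).
  have mgd : m <= 16 * g * d by apply: leq_trans nd; rewrite leq_pmull.
  have mm2 : m * m <= 256 * (g * g) * (d * d).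
    rewrite (_ : 256 * _ * _ = (16 * g * d) * (16 * g * d)); first exact: leq_mul.
    by clear; lia.
  have : N.+1 * (d * d) <= N * (d * d).
    apply: leq_trans (leq_trans (leq_addl _ _) p4) _.
    by move: mm2; rewrite /N -!mulnA !leq_mul2l => ->; rewrite !orbT.
  by rewrite leq_pmul2r ?ltnn // muln_gt0 d0.
pose A := filter (fun b => size b == q.+2) bs.
pose B := filter (predC (fun b => size b == q.+2)) bs.
have /andP[blk szs] := p2.
exists (map flatten A), (flatten (flatten B) ++ U); split.
- rewrite (perm_trans _ p1) // catA perm_cat2r.
  rewrite (_ : flatten (map flatten A) = flatten (flatten A)); last first.
    by elim: (A) => [//|a A' IH] /=; rewrite flatten_cat IH.
  rewrite -!flatten_cat; do 2!apply: perm_flatten.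
  by rewrite perm_filterC.
- rewrite all_map; apply/allP => b; rewrite mem_filter /= => /andP[/eqP sb bbs].
  by have [-> ->] := block1_pairwise (allP blk _ bbs); rewrite sb eqxx.
- have sB : size (flatten (flatten B)) <= q.+2 * count (fun b => size b != q.+2) bs.
    have -> : size (flatten (flatten B)) = size (flatten B).
      rewrite (@size_flatten_const _ _ 1) ?mul1n //.
      apply/allP => P /flattenP[b]; rewrite mem_filter => /andP[_ bbs] Pb.
      by have /andP[/allP h _] := allP blk _ bbs; apply: h.
    have : all (fun b => 0 < size b <= q.+2) B.
      apply/allP => b; rewrite mem_filter => /andP[_]; exact: (allP szs).
    by move/size_flatten_bounds/andP => [_]; rewrite size_filter.
  have f1 : s1 * size (flatten (flatten B) ++ U) <= q.+3 * (q.+2 * m).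
    rewrite size_cat mulnDr mulSn addnC leq_add ?(ltnW n1) //.
    apply: leq_trans (leq_mul (leqnn s1) sB) _.
    by rewrite mulnCA leq_mul2l; rewrite muln1 in n2; rewrite (ltnW n2) orbT.
  rewrite -(leq_pmul2l (ltn0Sn q.+2)); apply: leq_trans f1.
  rewrite mulnA leq_mul2r; apply/orP; right.
  by rewrite /s1 leq_pmulr // !muln_gt0 g0.
Qed.

(** * Absorbers *)

Section Tiling.
Variables (T : eqType) (e : rel T) (r : nat).

(** Working with sequences up to permutation turns unions into concatenations; the cliques are
    disjoint once [s] is duplicate-free. *)
Definition tileable (s : seq T) : Prop :=
  exists2 cs, all (fun c => (size c == r) && pairwise e c) cs &
    perm_eq (flatten cs) s.

Lemma tileable_nil : tileable [::].
Proof. by exists [::]. Qed.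

Lemma tileable_perm s t : perm_eq s t -> tileable s -> tileable t.
Proof. by move=> st [cs h p]; exists cs => //; apply: perm_trans p st. Qed.

Lemma tileable_cat s t : tileable s -> tileable t -> tileable (s ++ t).
Proof.
move=> [cs h p] [ct h' p']; exists (cs ++ ct); first by rewrite all_cat h.
by rewrite flatten_cat perm_cat.
Qed.

Lemma tileable_clique c : size c = r -> pairwise e c -> tileable c.
Proof. by move=> /eqP sc pc; exists [:: c]; rewrite /= ?sc ?pc ?cats0. Qed.

End Tiling.

Section Many.
Variables (T : finType) (b : nat).

(* At least [b] choices for the first entry, for each of them at least [b]
   choices for the second one, and so on for [k] entries, lead to [P]. *)
Fixpoint many (k : nat) (P : seq T -> bool) : bool :=
  if k is k'.+1 then b <= #|[set x | many k' (fun s => P (x :: s))]|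
  else P [::].

Lemma many_sub k (P Q : seq T -> bool) :
  (forall s, size s = k -> P s -> Q s) -> many k P -> many k Q.
Proof.
elim: k P Q => [|k IH] P Q PQ /=; first exact: PQ.
move/leq_trans; apply; apply/subset_leq_card/subsetP => x; rewrite !inE.
by apply: IH => s sk; apply: PQ; rewrite /= sk.
Qed.

Lemma many_cat k l (P : seq T -> bool) :
  many k (fun s => many l (fun t => P (s ++ t))) -> many (k + l) P.
Proof.
elim: k P => [//|k IH] P /=.
move/leq_trans; apply; apply/subset_leq_card/subsetP => x; rewrite !inE.
exact: IH.
Qed.

Lemma manyS k (P : seq T -> bool) :
  many k.+1 P = (b <= #|[set x | many k (fun s => P (x :: s))]|).
Proof. by []. Qed.

Lemma many0 (P : seq T -> bool) : many 0 P = P [::].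
Proof. by []. Qed.

End Many.
Arguments many : simpl never.

(** * Many absorbers for every [r]-tuple *)

Section Absorbers.
Variables (T : finType) (e : rel T) (kappa : T -> nat) (q m d : nat).
Hypothesis richT : rich e kappa q m d.
Local Notation r := q.+2.
Local Notation b := (8 * d).

Definition nbh (x : T) : {set T} := [set y | e x y].
Definition nbhs (zs : seq T) : {set T} := [set y | all (e^~ y) zs].
Definition high (l : nat) (x : T) : bool := m <= kappa x + l.

Lemma few_low l : #|[set x | ~~ high l x]| <= m - l.
Proof.
have [_ _ _ few _] := richT.
apply: leq_trans (few (m - l) (leq_subr _ _)).
apply: subset_leq_card; apply/subsetP => x; rewrite !inE /high.
by rewrite -ltnNge addnC -ltn_subRL.
Qed.

Lemma many_high l (D : {set T}) : #|D| <= #|[set x in D | high l x]| + (m - l).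
Proof.
apply: leq_trans (leq_add (leqnn _) (few_low l)).
rewrite -(cardsID [set x | high l x] D) leq_add //; apply: subset_leq_card.
  by apply/subsetP => x; rewrite !inE.
by apply/subsetP => x; rewrite !inE => /andP[].
Qed.

Lemma nbh_inter (D : {set T}) x :
  #|D| + q * m + 16 * d + kappa x <= #|D :&: nbh x| + r * m.
Proof.
have [cT _ deg _ _] := richT.
have := deg x; rewrite -/(nbh x) => dx.
have h1 := cardsUI D (nbh x); have h2 := max_card (D :|: nbh x).
by rewrite cT in h2; move: h1 h2 dx; lia.
Qed.

Lemma nbh_inter_high (D : {set T}) x : high b x ->
  #|D| <= #|D :&: nbh x| + m.
Proof. by have := nbh_inter D x; rewrite /high; lia. Qed.

Lemma nbhs_high zs : all (high b) zs -> r * m <= #|nbhs zs| + size zs * m.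
Proof.
have [cT _ _ _ _] := richT.
elim: zs => [_|z zs IH] /=.
  rewrite mul0n addn0 -cT; apply: subset_leq_card.
  by apply/subsetP => y; rewrite !inE.
case/andP=> hz /IH; have := nbh_inter_high (nbhs zs) hz.
have -> : nbhs (z :: zs) = nbhs zs :&: nbh z.
  by apply/setP => y; rewrite !inE /= andbC.
by move: #|_| #|_| => a1 a2; clear; lia.
Qed.

(** All but at most [m - 8d] vertices are high, and passing to the neighbourhood of a high vertex
    loses at most [m] vertices. *)
Lemma greedy_high k (D : {set T}) E : k * m + E <= #|D| ->
  many b k (fun zs => [&& all [in D] zs, all (high b) zs, pairwise e zs &
    E <= #|D :&: nbhs zs|]).
Proof.
have [_ _ _ _ dm] := richT.
elim: k D => [|k IH] D hD; rewrite ?many0 ?manyS /=.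
  have -> : nbhs [::] = setT by apply/setP => y; rewrite !inE.
  by rewrite setIT.
have := many_high b D => hi.
apply: leq_trans (_ : #|[set x in D | high b x]| <= _); first by lia.
apply: subset_leq_card; apply/subsetP => z; rewrite !inE => /andP[zD hz].
have hD' : k * m + E <= #|D :&: nbh z|.
  by have := nbh_inter_high D hz; lia.
apply: many_sub (IH _ hD') => zs _ /and4P[h1 h2 h3 h4].
rewrite /= zD hz h2 h3 /=; apply/and3P; split.
- by apply: sub_all h1 => y; rewrite inE => /andP[].
- by rewrite andbT; apply: sub_all h1 => y; rewrite !inE => /andP[].
- apply: leq_trans h4 _; apply: subset_leq_card; apply/subsetP => y.
  by rewrite !inE /= => /andP[/andP[-> ->]].
Qed.

Local Notation tileable := (tileable e r).

Definition swappable (x y : T) (s : seq T) : Prop :=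
  tileable (x :: s) /\ tileable (y :: s).

(* From [x] one moves to vertices of larger and larger [kappa], gaining at least
   [b] at each of the [p] steps, until a high-degree vertex is reached; two
   high-degree vertices have many cliques in their common neighbourhood. *)
Lemma many_swappable p x w : m <= kappa x + p.+1 * b -> high b w ->
  many b (q.+1 + p * r) (fun s => `[< swappable x w s >]).
Proof.
have [cT kle deg few dm] := richT.
move=> hx hw; elim: p x hx => [|p IH] x hx.
  rewrite mul0n addn0 -(addn1 q); apply: many_cat.
  rewrite mul1n in hx.
  (* Both [x] and [w] are high here; a [q]-clique [zs] and a vertex [z] from their common
     neighbourhood complete either of them to an [r]-clique. *)
  have hD : q * m + 16 * d <= #|nbh x :&: nbh w|.
    have := nbh_inter_high (nbh x) hw; have := deg x; rewrite -/(nbh x).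
    move: hw; rewrite /high; have := nbh_inter (nbh x) w; lia.
  apply: many_sub (greedy_high hD) => zs szs /and4P[h1 h2 h3 h4].
  rewrite manyS; apply: leq_trans (_ : 16 * d <= _); first by rewrite leq_mul2r orbT.
  apply: leq_trans h4 _; apply: subset_leq_card; apply/subsetP => z.
  rewrite !inE many0 => /andP[/andP[xz wz] /allP zsz].
  have cl u : e u z -> all (e u) zs -> tileable (u :: zs ++ [:: z]).
    move=> uz uzs; apply: tileable_clique; first by rewrite /= size_cat szs addn1.
    rewrite /= all_cat uzs /= uz pairwise_cat h3 /= andbT allrel1r.
    by apply/allP.
  by apply/asboolP; split; apply: cl => //; apply: sub_all h1 => y;
    rewrite !inE => /andP[].
rewrite (_ : q.+1 + p.+1 * r = q + (1 + (1 + (q.+1 + p * r)))); last by lia.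
apply: many_cat.
(* The cliques [x, zs, z] and [zs, z, y] exchange [x] with a vertex [y] of larger [kappa], from
   which the induction continues to [w]. A large [kappa z] leaves enough choices for [y]. *)
have hD : q * m + (16 * d + kappa x) <= #|nbh x| by rewrite addnA; apply: deg.
apply: many_sub (greedy_high hD) => zs szs /and4P[h1 h2 h3 h4].
set l := p.+1 * b.
have hl : m <= kappa x + b + l by move: hx; rewrite mulSn addnA.
rewrite !add1n manyS.
apply: leq_trans (_ : #|[set z in nbh x :&: nbhs zs | high l z]| <= _).
  rewrite -(leq_add2r (m - l)); apply: leq_trans (leq_trans h4 (many_high _ _)).
  by move: hl; clear; lia.
apply: subset_leq_card; apply/subsetP => z; rewrite !inE.
case/andP=> /andP[xz /allP zsz] hz; rewrite manyS.
apply: leq_trans (_ : #|[set y in nbhs zs :&: nbh z | high l y]| <= _).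
  have f2 : 16 * d + kappa z <= #|nbhs zs :&: nbh z|.
    rewrite -(leq_add2r (r * m)); apply: leq_trans (nbh_inter (nbhs zs) z).
    by have := nbhs_high h2; rewrite szs; move: #|_| => a1; clear; lia.
  rewrite -(leq_add2r (m - l)); apply: leq_trans (leq_trans f2 (many_high _ _)).
  by move: hz; rewrite /high; clear; lia.
apply: subset_leq_card; apply/subsetP => y; rewrite !inE.
case/andP=> /andP[/allP zsy zy] hy.
apply: many_sub (IH y hy) => s _ /asboolP[t1 t2]; apply/asboolP; split.
- have -> : x :: zs ++ z :: y :: s = (x :: zs ++ [:: z]) ++ (y :: s).
    by rewrite /= -catA.
  apply: tileable_cat t1; apply: tileable_clique.
    by rewrite /= size_cat szs addn1.
  rewrite /= all_cat /= xz andbT pairwise_cat h3 /= andbT allrel1r.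
  rewrite andbT; apply/andP; split; last exact/allP.
  by apply: sub_all h1 => u; rewrite inE.
- have pe : perm_eq ((zs ++ [:: z; y]) ++ [:: w] ++ s) (w :: zs ++ z :: y :: s).
    have -> : w :: zs ++ z :: y :: s = [:: w] ++ (zs ++ [:: z; y]) ++ s.
      by rewrite -catA.
    by rewrite perm_catCA.
  apply: (tileable_perm pe).
  apply: tileable_cat t2; apply: tileable_clique.
    by rewrite size_cat szs addn2.
  rewrite pairwise_cat h3 /= zy /= andbT; apply/allrelP => u v uzs.
  by rewrite !inE => /orP[] /eqP ->; [apply: zsz | apply: zsy].
Qed.

Lemma many_links p xs ws : m <= p.+1 * b -> size ws = size xs -> all (high b) ws ->
  many b (size xs * (q.+1 + p * r))
    (fun s => `[< tileable (s ++ ws) /\ tileable (s ++ xs) >]).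
Proof.
move=> hp; elim: xs ws => [|x xs IH] [|w ws] //=.
  by move=> _ _; apply/asboolP; split; apply: tileable_nil.
case=> sw /andP[hw hws]; rewrite (mulSn (size xs)); apply: many_cat.
have hx : m <= kappa x + p.+1 * b by apply: leq_trans hp (leq_addl _ _).
apply: many_sub (many_swappable hx hw) => s _ /asboolP[t1 t2].
apply: many_sub (IH ws sw hws) => s' _ /asboolP[t3 t4]; apply/asboolP.
have pe u us : perm_eq ((u :: s) ++ s' ++ us) ((s ++ s') ++ u :: us).
  by rewrite -[in X in perm_eq _ X](cat1s u us) perm_sym perm_catCA -catA.
by split; apply: (tileable_perm (pe _ _)); apply: tileable_cat.
Qed.

Definition absorbs (Q s : seq T) : Prop := tileable s /\ tileable (s ++ Q).

(** An absorber is an [r]-clique [ws] of high vertices followed by vertices [s] that exchange [Q]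
    with [ws]. Alone, [s] is tiled together with [ws]; in the presence of [Q], it is tiled together
    with [Q], and [ws] is a clique of its own. *)
Lemma many_absorbers p Q : m <= p.+1 * b -> size Q = r ->
  many b (r + r * (q.+1 + p * r)) (fun s => `[< absorbs Q s >]).
Proof.
have [cT _ _ _ _] := richT.
move=> hp sQ; apply: many_cat.
have hD : r * m + 0 <= #|[set: T]| by rewrite addn0 cardsT cT.
apply: many_sub (greedy_high hD) => ws sws /and4P[_ h2 h3 _].
have sw : size ws = size Q by rewrite sQ.
have := many_links hp sw h2; rewrite sQ; apply: many_sub => s _ /asboolP[t1 t2]; apply/asboolP; split.
  by apply: tileable_perm t1; rewrite perm_catC.
by rewrite -catA; apply: tileable_cat t2; apply: tileable_clique.
Qed.

End Absorbers.

(** * Greedy choice of disjoint absorbers *)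

Section Count.
Variable T : finType.

(** Each choice is denied at most [B] vertices: those of [A] and the earlier entries. *)
Lemma many_avoid b B k (P : seq T -> bool) (A : seq T) :
  many b k P -> size A + k <= B ->
  many (b - B) k (fun s => [&& P s, uniq s & ~~ has [in A] s]).
Proof.
elim: k P A => [|k IH] P A; first by rewrite !many0 => ->.
rewrite !manyS => hP hB.
apply: leq_trans (_ : #|[set x | many b k (fun s => P (x :: s))] :\: [set x in A]| <= _).
  rewrite cardsD leq_sub // (leq_trans (subset_leq_card (subsetIr _ _))) //.
  rewrite cardsE (leq_trans (card_size A)) //.
  by rewrite (leq_trans _ hB) // leq_addr.
apply: subset_leq_card; apply/subsetP => x; rewrite !inE => /andP[xA hx].
have hB' : size (x :: A) + k <= B by rewrite /= addSnnS.
apply: many_sub (IH _ _ hx hB') => s _ /and3P[h1 h2 /hasPn h3] /=.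
rewrite h1 h2 (negbTE xA) andbT /=; apply/andP; split.
  by apply/negP => xs; have := h3 x xs; rewrite /= inE eqxx.
by apply/hasPn => y ys; have := h3 y ys; rewrite /= inE negb_or => /andP[].
Qed.

Lemma many_count b k (P : seq T -> bool) :
  many b k P -> b ^ k <= #|[set s : k.-tuple T | P s]|.
Proof.
elim: k P => [|k IH] P.
  rewrite many0 => P0; rewrite expn0 card_gt0; apply/set0Pn.
  by exists [tuple]; rewrite inE.
rewrite manyS => hP.
pose f (p : T * k.-tuple T) := [tuple of p.1 :: p.2].
have finj : injective f.
  by move=> [x s] [y t] /(congr1 val) [-> /val_inj ->].
pose S := [set p : T * k.-tuple T | P (p.1 :: p.2)].
have fS : #|S| <= #|[set s : k.+1.-tuple T | P s]|.
  rewrite -(card_imset S finj); apply: subset_leq_card.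
  by apply/subsetP => s /imsetP[p]; rewrite !inE => h ->.
apply: leq_trans fS; rewrite /S -sum1dep_card.
rewrite -(pair_big_dep xpredT (fun x (s : k.-tuple T) => P (x :: s)) (fun _ _ => 1)) /=.
set X := [set x | _] in hP.
apply: leq_trans (_ : \sum_(x in X) b ^ k <= _).
  by rewrite sum_nat_const expnS leq_mul2r hP orbT.
rewrite [leqRHS](bigID [in X]) /= -[leqLHS]addn0 leq_add //.
apply: leq_sum => x; rewrite inE => /IH; move/leq_trans; apply.
by rewrite sum1dep_card.
Qed.

Lemma sum_ge_exists (I : finType) (v : I -> nat) c k W :
  0 < W -> 0 < #|I| -> #|I| <= c * k -> k * W <= \sum_i v i ->
  exists i, W <= c * v i.
Proof.
move=> W0 I0 Ick kW.
case: (pickP (fun i => W <= c * v i)) => [i hi|no]; first by exists i.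
have : \sum_i c * v i <= \sum_(i : I) W.-1.
  by apply: leq_sum => i _; have := no i; move: (c * v i); clear; lia.
rewrite -big_distrr sum_nat_const /= => h.
have h1 : #|I| * W <= #|I| * W.-1.
  apply: leq_trans h; apply: leq_trans (leq_mul Ick (leqnn W)) _.
  by rewrite -mulnA leq_mul2l kW orbT.
by rewrite leq_pmul2l // in h1; move: h1 W0; clear; lia.
Qed.

Variables (r a : nat) (ab : seq T -> seq T -> bool) (B k c : nat).
Hypothesis T0 : 0 < #|T|.
Hypothesis cT : #|T| ^ a <= c * k.
Hypothesis many_ab : forall (Q : r.-tuple T) (A : seq T), size A + a <= B ->
  k <= #|[set s : a.-tuple T | [&& ab Q s, uniq s & ~~ has [in A] s]]|.

(* Weighting each [r]-tuple by [2 ^ - (number of absorbers chosen so far)], an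
   average new absorber removes a fixed proportion of the total weight. *)
Definition weight (F : seq (seq T)) : nat :=
  \sum_(Q : r.-tuple T) 2 ^ (size F - count (ab Q) F).

Lemma greedy_family N : N * a <= B ->
  exists F : seq (seq T), [/\ size F = N, uniq (flatten F),
    all (fun s => (size s == a) && [exists Q : r.-tuple T, ab Q s]) F &
    c ^ N * weight F <= #|T| ^ r * (2 * c).-1 ^ N].
Proof.
elim: N => [_|N IH hB].
  exists [::]; split => //; rewrite /weight /= mul1n sum_nat_const card_tuple.
  by rewrite !expn0 !muln1.
have [|F [sF uF aF wF]] := IH; first by apply: leq_trans hB; rewrite mulSn leq_addl.
have sfF : size (flatten F) = N * a.
  rewrite (@size_flatten_const _ _ a) ?sF 1?mulnC //.
  by apply: sub_all aF => s /andP[].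
have hA : size (flatten F) + a <= B by rewrite sfF addnC -mulSn.
pose w (Q : r.-tuple T) := 2 ^ (size F - count (ab Q) F).
pose good (Q : r.-tuple T) (s : a.-tuple T) :=
  [&& ab Q s, uniq s & ~~ has [in flatten F] s].
pose v s := \sum_(Q | good Q s) w Q.
have W0 : 0 < weight F.
  have /card_gt0P[x _] := T0.
  rewrite /weight (bigD1 [tuple of nseq r x]) //=.
  by rewrite addn_gt0 expn_gt0.
have [|||s hs] := @sum_ge_exists _ v c k (weight F) W0.
- by rewrite card_tuple expn_gt0 T0.
- by rewrite card_tuple.
- rewrite /v (exchange_big_dep xpredT) //= /weight big_distrr /=.
  by apply: leq_sum => Q _; rewrite sum_nat_cond_const leq_mul2r; apply/orP; right; apply: many_ab.
have [Q0 gQ0] : exists Q, good Q s.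
  case: (pickP (good^~ s)) => [Q gQ|no]; first by exists Q.
  move: hs W0; rewrite /v big_pred0 // muln0; move: (weight F); clear; lia.
have /and3P[abs us /hasPn ds] := gQ0.
exists ((s : seq T) :: F); split => /=.
- by rewrite sF.
- rewrite cat_uniq us uF andbT /=; apply/hasPn => x xF.
  by apply/negP => xs; have := ds x xs; rewrite /= xF.
- by rewrite aF size_tuple eqxx andbT /=; apply/existsP; exists Q0.
- have hw : weight ((s : seq T) :: F) + v s = 2 * weight F.
    rewrite /weight /v big_distrr /= [\sum_(Q | good Q s) _]big_mkcond -big_split /=.
    apply: eq_bigr => Q _.
    have cF : count (ab Q) F <= size F by apply: count_size.
    have -> : good Q s = ab Q s by rewrite /good us /= andbC; case/and3P: gQ0 => _ _ ->.
    case: (ab Q s); rewrite /= ?add0n ?addn0.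
      by rewrite add1n subSS /w mul2n addnn.
    by rewrite subSn // expnS.
  have f1 : c * weight ((s : seq T) :: F) <= (2 * c).-1 * weight F.
    move: hw hs; move: (weight _) (weight F) (v s) => w1 w2 v1; clear.
    have [-> _|c0] := posnP c; first by rewrite !mul0n.
    move=> h1 h2; have h3 : c * (w1 + v1) = c * (2 * w2) by rewrite h1.
    have h4 : (2 * c).-1 * w2 + w2 = c * (2 * w2).
      by rewrite -{2}(mul1n w2) -mulnDl addn1 prednK ?muln_gt0 //; lia.
    lia.
  rewrite expnS [leqRHS](_ : _ = (2 * c).-1 * (#|T| ^ r * (2 * c).-1 ^ N)).
    apply: leq_trans (_ : c ^ N * ((2 * c).-1 * weight F) <= _).
      by rewrite -mulnA mulnCA leq_mul2l f1 orbT.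
    by rewrite mulnCA leq_mul2l wF orbT.
  by rewrite expnS; move: (#|T| ^ r) ((2 * c).-1 ^ N) ((2 * c).-1); clear; lia.
Qed.

(** Bernoulli's inequality: for [x = 2c - 1], the power of [1 + 1 / x] with exponent [3 * (x + 1)]
    is at least [1 + 3 * (x + 1) / x >= 4]. *)
Lemma pow_gap : 0 < c -> 4 * (2 * c).-1 ^ (6 * c) <= (2 * c) ^ (6 * c).
Proof.
move=> c0; case E : (2 * c) => [|x]; first by move: E c0; clear; lia.
rewrite /= (_ : 6 * c = 3 * x.+1); last by rewrite -E; clear; lia.
have bern j : x ^ j.+1 + j.+1 * x ^ j <= x.+1 ^ j.+1.
  elim: j => [|j IHj]; first by rewrite !expn1 expn0; lia.
  rewrite [in leqRHS]expnS; apply: leq_trans (leq_mul (leqnn x.+1) IHj).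
  rewrite (expnS x j.+1) (expnS x j); move: (x ^ j) => y; clear; nia.
have := bern (3 * x.+1).-1; rewrite prednK //; apply: leq_trans.
have -> : x ^ (3 * x.+1) = x * x ^ (3 * x.+1).-1 by rewrite -expnS prednK.
by move: (x ^ _) => y; clear; nia.
Qed.

(** For [N = 6 * c * K], a tuple with fewer than [K] absorbers alone has weight at least
    [2 ^ (N - K)], but the total weight is at most [#|T| ^ r * 2 ^ N / 4 ^ K], which is smaller. *)
Lemma absorbing_family K : 0 < c -> 6 * c * K * a <= B -> #|T| ^ r < 2 ^ K ->
  exists F : seq (seq T), [/\ size F = 6 * c * K, uniq (flatten F),
    all (fun s => (size s == a) && [exists Q : r.-tuple T, ab Q s]) F &
    forall Q : r.-tuple T, K <= count (ab Q) F].
Proof.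
move=> c0 hB hK.
have [F [sF uF aF wF]] := greedy_family hB.
exists F; split => // Q; apply/ltnW; rewrite ltnNge; apply/negP => cQ.
set N := 6 * c * K in sF wF.
have KN : K <= N by rewrite /N leq_pmull // muln_gt0.
have f1 : 2 ^ (N - K) <= weight F.
  apply: leq_trans (_ : 2 ^ (size F - count (ab Q) F) <= _).
    by rewrite leq_exp2l // sF leq_sub2l.
  by rewrite /weight (bigD1 Q) //= leq_addr.
have f2 : (2 * c) ^ N <= 2 ^ K * (#|T| ^ r * (2 * c).-1 ^ N).
  apply: leq_trans (leq_mul (leqnn (2 ^ K)) wF).
  rewrite expnMn -{1}(subnKC KN) expnD -mulnA leq_mul2l mulnC.
  by rewrite leq_mul2l f1 !orbT.
have f3 : 4 ^ K * (2 * c).-1 ^ N <= (2 * c) ^ N.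
  rewrite /N !(expnM _ (6 * c)) -expnMn; case: (K) => [|K']; first by rewrite !expn0.
  by rewrite leq_exp2r // pow_gap.
have y0 : 0 < (2 * c).-1 ^ N.
  by rewrite expn_gt0; apply/orP; left; move: c0; clear; lia.
have := leq_trans f3 f2; rewrite mulnA leq_pmul2r //.
rewrite (_ : 4 = 2 * 2) // expnMn leq_pmul2l ?expn_gt0 // leqNgt.
by rewrite hK.
Qed.

End Count.

(** * Perfect packings *)

Lemma tileable_flatten (T : eqType) (e : rel T) r (F : seq (seq T)) :
  (forall s, s \in F -> tileable e r s) -> tileable e r (flatten F).
Proof.
elim: F => [_|s F IH h] /=; first exact: tileable_nil.
apply: tileable_cat; first exact/h/mem_head.
by apply: IH => t tF; apply: h; rewrite inE tF orbT.
Qed.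

Lemma absorb_all (T : finType) (e : rel T) q (F : seq (seq T)) l (L : seq T) :
  (forall s, s \in F -> tileable e q.+2 s) ->
  (forall Q : q.+2.-tuple T, l <= count (fun s => `[< absorbs e q Q s >]) F) ->
  size L = q.+2 * l -> tileable e q.+2 (flatten F ++ L).
Proof.
elim: l F L => [|l IH] F L tF hQ sL.
  by rewrite (size0nil (s := L)) ?sL ?muln0 // cats0; apply: tileable_flatten.
have sQ : size (take q.+2 L) == q.+2.
  by rewrite size_take_min sL; apply/eqP/minn_idPl; rewrite mulnS leq_addr.
pose Q := Tuple sQ.
have /hasP[s sF /asboolP[_ tsQ]] : has (fun s => `[< absorbs e q Q s >]) F.
  by rewrite has_count; apply: leq_trans (hQ Q).
have pF := perm_to_rem sF.
have tL : tileable e q.+2 (flatten (rem s F) ++ drop q.+2 L).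
  apply: IH => [t /mem_rem|Q'|]; first exact: tF.
    have := hQ Q'; rewrite (permP pF) /=.
    by move: (count _ _) => x; case: `[< _ >] => /=; clear; lia.
  by rewrite size_drop sL mulnS addKn.
have pe : perm_eq ((s ++ take q.+2 L) ++ flatten (rem s F) ++ drop q.+2 L)
    (flatten F ++ L).
  rewrite -[in X in perm_eq _ X](cat_take_drop q.+2 L) perm_catACA.
  rewrite perm_cat2r; rewrite perm_sym; exact: perm_flatten pF.
by apply: (tileable_perm pe); apply: tileable_cat.
Qed.

Section Restrict.
Variables (T : finType) (e : rel T) (kappa : T -> nat) (q m d D : nat) (A : seq T).
Hypothesis richT : rich e kappa q m D.
Variable a : nat.
Hypothesis sA : size A = q.+2 * a.
Hypothesis uA : uniq A.
Hypothesis Dd : size A + 16 * d <= 16 * D.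
Hypothesis ma : 8 * d + a <= m.

Local Notation T' := {x : T | x \notin A}.

Lemma perm_restrict : perm_eq (map val (enum {: T'}) ++ A) (enum T).
Proof.
apply: uniq_perm; rewrite ?enum_uniq //.
  rewrite cat_uniq uA andbT map_inj_uniq ?enum_uniq; last exact: val_inj.
  by apply/hasPn => x xA; apply/mapP => -[[y yA] _ xy]; rewrite /= in xy; rewrite -xy xA in yA.
move=> x; rewrite mem_cat [RHS]mem_enum [RHS]inE.
case xA : (x \in A); rewrite ?orbT // orbF; apply/mapP.
by exists (exist _ x (negbT xA)); rewrite // mem_enum.
Qed.

(** Removing [A] costs each degree at most [size A], paid by the larger slack [D]; [kappa] is capped
    because [m] drops to [m - a]. *)
Lemma rich_restrict :
  rich (relpre (val : T' -> T) e) (fun x => minn (kappa (val x)) (m - a)) q (m - a) d.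
Proof.
have [cT kle deg few dm] := richT.
have am : a <= m by apply: leq_trans ma; rewrite leq_addl.
split.
- have := perm_size perm_restrict; rewrite size_cat size_map -!cardE cT sA.
  by rewrite mulnBr => <-; rewrite addnK.
- by move=> x; apply: geq_minr.
- move=> x.
  have h : #|[set y | e (val x) y]| <= #|[set y : T' | e (val x) (val y)]| + size A.
    rewrite -(card_imset _ val_inj).
    apply: leq_trans (leq_add (leqnn _) (card_size A)).
    rewrite -(cardsE [in A]).
    apply: leq_trans (leq_card_setU _ _); apply: subset_leq_card.
    apply/subsetP => y; rewrite !inE => xy; case yA : (y \in A); rewrite ?orbT // orbF.
    by apply/imsetP; exists (exist _ y (negbT yA)); rewrite ?inE.
  apply: leq_trans (_ : #|[set y | e (val x) y]| - size A <= _); last first.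
    by rewrite leq_subLR addnC.
  rewrite leq_subRL; last first.
    apply: leq_trans (deg (val x)); apply: leq_trans (leq_addr _ _).
    by apply: leq_trans (leq_addl _ _); apply: leq_trans Dd; rewrite leq_addr.
  apply: leq_trans (deg (val x)).
  have f1 : q * (m - a) <= q * m by rewrite leq_mul2l leq_subr orbT.
  have f2 := geq_minl (kappa (val x)) (m - a).
  by move: f1 f2 Dd; move: (q * _) (q * m) (minn _ _) (size A); clear; lia.
- move=> i im; have im' : i <= m by apply: leq_trans im (leq_subr _ _).
  apply: leq_trans (few i im'); rewrite -(card_imset _ val_inj).
  apply: subset_leq_card; apply/subsetP => _ /imsetP[x + ->].
  by rewrite !inE gtn_min => /orP[//|]; rewrite ltnNge im.
- by rewrite leq_subRL // addnC.
Qed.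

End Restrict.

Lemma tileable_val (T : finType) (e : rel T) r (p : pred T) (s : seq {x | p x}) :
  tileable (relpre val e) r s -> tileable e r (map val s).
Proof.
case=> cs hcs pcs; exists (map (map val) cs).
  rewrite all_map; apply: sub_all hcs => c /=.
  by rewrite size_map pairwise_map.
by rewrite -map_flatten perm_map.
Qed.

Lemma exp_beats_linear y j : 4 * y <= j -> y * j.+1 < 2 ^ j.
Proof.
move=> yj; set i := j./2; have ij : i.*2 <= j by rewrite -geq_half_double.
have ji : j.+1 <= 2 * i.+1 by rewrite /i; move: (j); clear; lia.
have yi : 2 * y < i.+1 by rewrite /i; move: yj; clear; lia.
have h : i.+1 * i.+1 <= 2 ^ j.
  apply: leq_trans (_ : 2 ^ i * 2 ^ i <= _).
    by apply: leq_mul; apply: ltn_expl.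
  by rewrite -expnD addnn leq_exp2l.
apply: leq_ltn_trans (leq_mul (leqnn y) ji) _.
by apply: leq_trans h; rewrite mulnCA mulnA ltn_pmul2r.
Qed.

Lemma exp_beats_poly x r : exists M, forall K, M <= K -> (x * K.+1) ^ r < 2 ^ K.
Proof.
case: r => [|r]; first by exists 1 => -[//|K] _; rewrite expn0 -[1](expn0 2) ltn_exp2l.
exists (r.+1 * (4 * (x * r.+1))) => K hK.
set j := K %/ r.+1.
have hj : 4 * (x * r.+1) <= j by rewrite leq_divRL // mulnC.
have Kj : K.+1 <= r.+1 * j.+1 by rewrite mulnC ltn_ceil.
apply: leq_ltn_trans (_ : (x * (r.+1 * j.+1)) ^ r.+1 < _).
  by rewrite leq_exp2r // leq_mul2l Kj orbT.
apply: leq_trans (_ : (2 ^ j) ^ r.+1 <= _).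
  by rewrite ltn_exp2r // mulnA exp_beats_linear.
by rewrite -expnM leq_exp2l // leq_divM.
Qed.

(** The slack is [2 * d] so that [d] remains once the absorbing family is removed. *)
Lemma tile_all q g : 0 < g -> exists m0, forall (T : finType) (e : rel T) kappa m d,
  m0 <= m -> rich e kappa q m (2 * d) -> q.+2 * m <= 16 * g * d ->
  tileable e q.+2 (enum T).
Proof.
(* Since [m <= 16 * g * d], [g] upward moves reach a high vertex, which gives absorbers of [a]
   vertices; [(8 * d) ^ a] is a proportion at least [1 / c] of all [a]-tuples. *)
move=> g0; pose a' := (q.+1 + g * q.+2).+1; pose a := q.+2 * a'.
pose c := (2 * g) ^ a; pose C := 6 * c * a.
have c0 : 0 < c by rewrite expn_gt0 muln_gt0 g0.
have a0 : 0 < a by [].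
have C0 : 0 < C by rewrite /C (muln_gt0 (6 * c)) (muln_gt0 6) c0 a0.
(* This factor leaves at most [r * K] vertices uncovered, few enough for [K] absorbers per tuple. *)
have s0 : 0 < 32 * g * C by rewrite (muln_gt0 (32 * g)) (muln_gt0 32) g0 C0.
have [m1 Hm1] := near_perfect q g0 s0.
have [M HM] := exp_beats_poly (16 * g * C) q.+2.
exists (2 * m1 + 16 * g * (C * M.+1)) => T e kappa m d mbig hr nd.
have [cT kle deg few dm] := hr.
have dM : C * M.+1 <= d.
  rewrite -(leq_pmul2l (_ : 0 < 16 * g)) ?muln_gt0 //; apply: leq_trans nd.
  by apply: leq_trans (leq_trans (leq_addl _ _) mbig) _; rewrite leq_pmull.
(* The [6 * c * K] absorbers then have at most [d] vertices, while [K] is linear in [d], as needed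
   for [2 ^ K] to exceed [#|T| ^ r]. *)
pose K := d %/ C.
have KM : M < K by rewrite leq_divRL // mulnC.
have KC : K * C <= d by rewrite leq_divM.
have dKC : d < K.+1 * C by rewrite ltn_ceil.
have nK : #|T| ^ q.+2 < 2 ^ K.
  apply: leq_ltn_trans (HM _ (ltnW KM)); rewrite leq_exp2r // cT.
  apply: leq_trans nd _; rewrite -(mulnA _ C) leq_mul2l.
  by rewrite (mulnC C) (ltnW dKC) orbT.
pose ab (Q s : seq T) := `[< absorbs e q Q s >].
have T0 : 0 < #|T|.
  have : 0 < d by apply: leq_trans dM; rewrite muln_gt0 C0.
  by rewrite cT muln_gt0 /=; move: dm; clear; lia.
have cTa : #|T| ^ a <= c * (8 * d) ^ a.
  rewrite /c -expnMn leq_exp2r // cT; apply: leq_trans nd _.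
  by rewrite (_ : 2 * g * (8 * d) = 16 * g * d) //; clear; lia.
have many_ab (Q : q.+2.-tuple T) (A : seq T) : size A + a <= 8 * d ->
    (8 * d) ^ a <= #|[set s : a.-tuple T | [&& ab Q s, uniq s & ~~ has [in A] s]]|.
  move=> hA; have hp : m <= g.+1 * (8 * (2 * d)).
    have : m <= 16 * g * d by apply: leq_trans nd; rewrite leq_pmull.
    by move/leq_trans; apply; move: (d) => x; clear; nia.
  have := many_absorbers hr hp (size_tuple Q).
  rewrite (_ : q.+2 + q.+2 * _ = a); last by rewrite /a /a' [RHS]mulnS.
  move=> hm; have := many_avoid hm hA.
  rewrite (_ : 8 * (2 * d) - 8 * d = 8 * d); last by clear; lia.
  exact: many_count.
have Ka : 6 * c * K * a <= 8 * d.
  apply: leq_trans (_ : d <= _); last by rewrite leq_pmull.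
  by apply: leq_trans KC; rewrite /C mulnC mulnA -!mulnA [K * _]mulnCA; move: (6) => x; clear; lia.
have [F [sF uF aF hF]] := absorbing_family T0 cTa many_ab c0 Ka nK.
have tF s : s \in F -> tileable e q.+2 s.
  by move/(allP aF) => /andP[_ /existsP[Q /asboolP[]]].
set N := 6 * c * K in sF Ka.
have sA : size (flatten F) = q.+2 * (a' * N).
  rewrite (@size_flatten_const _ _ a) ?sF ?mulnA //.
  by apply: sub_all aF => s /andP[].
have sA8 : size (flatten F) <= 8 * d by rewrite sA mulnA mulnC.
have a'N : a' * N <= 8 * d by apply: leq_trans sA8; rewrite sA leq_pmull.
have Dd : size (flatten F) + 16 * d <= 16 * (2 * d).
  by move: sA8; move: (size _) => x; clear; lia.
have ma : 8 * d + a' * N <= m.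
  by move: a'N dm; move: (a' * N) => x; clear; lia.
have hr' := rich_restrict hr sA uF Dd ma.
have m1m : m1 <= m - a' * N.
  have : 2 * m1 <= m by apply: leq_trans mbig; rewrite leq_addr.
  by move: a'N dm; move: (a' * N) => x; clear; lia.
have nd' : q.+2 * (m - a' * N) <= 16 * g * d.
  by apply: leq_trans nd; rewrite leq_mul2l leq_subr orbT.
have [cs [U [pU acs sU]]] := Hm1 _ _ _ _ _ m1m hr' nd'.
have scs : size (flatten cs) = q.+2 * size cs.
  by apply: size_flatten_const; apply: sub_all acs => c' /andP[].
have [l lE] : exists l, size U = q.+2 * l.
  have := perm_size pU; rewrite size_cat scs -cardE (rich_card hr') => h.
  by exists (m - a' * N - size cs); rewrite mulnBr -h addKn.
have lK : l <= K.
  have h1 : 32 * g * C * l <= 16 * g * d.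
    rewrite -(leq_pmul2l (ltn0Sn q.+1)) mulnCA -lE.
    apply: leq_trans sU _; rewrite leq_mul2l /=.
    apply: leq_trans (leq_subr _ _) _; apply: leq_trans nd.
    by rewrite leq_pmull.
  have K1 : K.+1 <= 2 * K by move: KM; clear; lia.
  have h2 : 16 * g * d <= 16 * g * (2 * K * C).
    by rewrite leq_mul2l (leq_trans (ltnW dKC)) ?orbT // leq_mul2r K1 orbT.
  have := leq_trans h1 h2; rewrite (_ : _ * (2 * K * C) = 32 * g * C * K).
    by rewrite leq_pmul2l.
  by clear; lia.
have tU : tileable e q.+2 (flatten F ++ map val U).
  apply: (absorb_all (l := l)) => //; last by rewrite size_map.
  by move=> Q; apply: leq_trans lK (hF Q).
have tcs : tileable e q.+2 (map val (flatten cs)).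
  by apply: tileable_val; exists cs.
apply: tileable_perm (perm_restrict uF) _.
apply: (tileable_perm (s := map val (flatten cs) ++ (flatten F ++ map val U))).
  rewrite perm_sym perm_catC perm_sym perm_catCA.
  by rewrite perm_cat2l -map_cat perm_map.
exact: tileable_cat.
Qed.

(** * Clique tilings as packings *)

Lemma uniq_flatten_mem (T : eqType) (cs : seq (seq T)) c c' x :
  uniq (flatten cs) -> c \in cs -> c' \in cs -> x \in c -> x \in c' -> c = c'.
Proof.
elim: cs => [//|b cs IH] /=; rewrite cat_uniq => /and3P[_ /hasPn nb ucs].
have no y s : s \in cs -> y \in s -> y \notin b.
  by move=> scs ys; apply: nb; apply/flattenP; exists s.
rewrite !inE => /orP[/eqP ->|ccs] /orP[/eqP ->|c'cs] // xc xc'.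
- by have := no _ _ c'cs xc'; rewrite xc.
- by have := no _ _ ccs xc; rewrite xc'.
- exact: IH.
Qed.

Lemma packing_of_tileable (G : sgraph) r : tileable (@adj G) r (enum G) ->
  exists P : {set {ffun complete_graph r -> G}}, is_perfect_packing P.
Proof.
case=> cs /allP hcs pcs.
(* [nth] needs a default vertex, hence the separate treatment of the empty graph. *)
case: (pickP [pred x : G | true]) => [x0 _|no]; last first.
  exists set0; split; first by split=> f; rewrite inE.
  by move=> x; have := no x.
have ucs : uniq (flatten cs) by rewrite (perm_uniq pcs) enum_uniq.
pose F (c : seq G) : {ffun complete_graph r -> G} :=
  [ffun i : complete_graph r => nth x0 c (nat_of_ord i)].
have codomF c : c \in cs -> codom (F c) =i c.
  move=> /hcs /andP[/eqP sc _] x; apply/codomP/idP => [[i ->]|xc].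
    by rewrite ffunE mem_nth // sc.
  have ix : index x c < r by rewrite -sc index_mem.
  by exists (Ordinal ix : complete_graph r); rewrite ffunE /= nth_index.
exists [set f | has (fun c => f == F c) cs]; split; first split.
- move=> f; rewrite inE => /hasP[c ccs /eqP ->].
  have /andP[/eqP sc /(pairwiseP x0) pc] := hcs _ ccs.
  have adjc (i j : 'I_r) : i < j -> adj (nth x0 c i) (nth x0 c j).
    by move=> ij; apply: pc => //; rewrite inE sc.
  have adjF (i j : 'I_r) : i != j -> adj (nth x0 c i) (nth x0 c j).
    case: (ltngtP i j) => [/adjc //|/adjc|/val_inj ->]; last by rewrite eqxx.
    by rewrite adj_sym.
  split=> [i j|i j ij]; rewrite !ffunE; last exact: adjF.
  move=> eij; apply/eqP; apply: contraT => /(adjF i j).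
  by rewrite eij adj_irrefl.
- move=> f g; rewrite !inE => /hasP[c ccs /eqP ->] /hasP[c' c'cs /eqP ->] ne.
  apply/pred0P => x /=; apply/negP => /andP[].
  rewrite codomF // codomF // => xc xc'.
  by move: ne; rewrite (uniq_flatten_mem ucs ccs c'cs xc xc') eqxx.
- move=> x; have : x \in flatten cs by rewrite (perm_mem pcs) mem_enum.
  case/flattenP=> c ccs xc; exists (F c); last by rewrite codomF.
  by rewrite inE; apply/hasP; exists c.
Qed.

(** * Degree sequences *)

Lemma sorted_count (s : seq nat) t j : sorted leq s -> j < size s ->
  t <= nth 0 s j -> count (fun x => x < t) s <= j.
Proof.
move=> ss js tj; rewrite -{1}(cat_take_drop j s) count_cat.
rewrite [X in _ + X](_ : _ = 0) ?addn0.
  by rewrite (leq_trans (count_size _ _)) // size_take_min geq_minl.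
apply/eqP; rewrite -leqn0 leqNgt -has_count; apply/hasPn => x /(nthP 0)[i].
rewrite size_drop nth_drop => il <-; rewrite -leqNgt (leq_trans tj) //.
apply: sorted_leq_nth => //; rewrite ?inE ?leq_addr //.
- exact: leq_trans.
- by rewrite -ltn_subRL.
Qed.

Lemma few_low_degree (G : sgraph) t i : 0 < i -> i <= #|G| -> t <= deg_at G i ->
  #|[set x : G | degree x < t]| < i.
Proof.
move=> i0 iG ti; have := @sorted_count (degree_seq G) t i.-1.
rewrite sort_sorted; last exact: leq_total.
rewrite size_sort size_map -cardE prednK // => /(_ isT iG ti).
rewrite -(ltn_predK i0) ltnS; apply: leq_trans.
by rewrite count_sort count_map card_set_count.
Qed.

(** The index of a vertex is read off its degree. The condition at [i = 1] bounds all degrees from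
    below, so the truncated subtraction is exact. *)
Lemma rich_degrees (G : sgraph) q m D : #|G| = q.+2 * m -> 1 < m ->
  (forall i, 0 < i -> i < m -> (q * m + i + 16 * D).+1 <= deg_at G i) ->
  rich (@adj G) (fun x => minn m (degree x - (q * m + 16 * D))) q m D.
Proof.
move=> cG m1 hdeg.
have mG : m <= #|G| by rewrite cG leq_pmull.
have degmin (x : G) : q * m + 16 * D <= degree x.
  rewrite leqNgt; apply/negP => xlow.
  have := few_low_degree (ltnSn 0) (leq_trans (ltnW m1) mG) (hdeg 1 (ltnSn 0) m1).
  rewrite ltnS leqn0 cards_eq0 => /eqP/setP/(_ x).
  by rewrite !inE; move: xlow; lia.
split => //.
- by move=> x; apply: geq_minl.
- move=> x; apply: leq_trans (_ : degree x <= _) => //.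
  by have := degmin x; have := geq_minr m (degree x - (q * m + 16 * D)); lia.
- case=> [_|i im].
    by rewrite leqn0 cards_eq0; apply/eqP/setP => x; rewrite !inE.
  (* The hypothesis stops at [m.-1]; its surplus of 1 lets [j = m.-1] also serve [i.+1 = m]. *)
  have [j [j0 jm ji ij]] : exists j, [/\ 0 < j, j < m, j <= i.+1 & i.+1 <= j.+1].
    have [->|/eqP ne] := eqVneq i.+1 m; first by exists m.-1; split; lia.
    by exists i.+1; split; lia.
  have := few_low_degree j0 (leq_trans (ltnW jm) mG) (hdeg j j0 jm).
  move=> h; apply: leq_trans ji; apply: leq_trans (ltnW h).
  apply: subset_leq_card; apply/subsetP => x; rewrite !inE gtn_min.
  by have := degmin x; lia.
- have /card_gt0P[x _] : 0 < #|G| by apply: leq_trans mG; lia.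
  have := degmin x; have := max_card [set y : G | adj x y].
  by rewrite cG -/(degree x); lia.
Qed.

(** * Integer constants from [gamma] *)

Import Order.TTheory GRing.Theory Num.Theory.
Local Open Scope ring_scope.

Theorem theorem1p3 (R : realType) (gamma : R) (r : nat)
    (gamma_gt0 : 0 < gamma) (r_gt0 : (0 < r)%N) :
  exists n0 : nat, forall (G : sgraph) (n : nat),
    #|G| = n -> (n0 <= n)%N -> (r %| n)%N ->
    (forall i : nat, (0 < i)%N -> i%:R < n%:R / r%:R :> R ->
       (r%:R - 2) * n%:R / r%:R + i%:R + gamma * n%:R
         <= (deg_at G i)%:R) ->
    exists P : {set {ffun complete_graph r -> G}}, is_perfect_packing P.
Proof.
case: r r_gt0 => [//|[|q]] _.
  exists 0%N => G n _ _ _ _; apply: packing_of_tileable.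
  exists [seq [:: x] | x <- enum G]; last by rewrite flatten_map1 map_id.
  by rewrite all_map; apply/allP.
pose g := Num.bound (2 / gamma).
have hg : 2 < gamma * g%:R.
  rewrite mulrC -ltr_pdivrMr //; apply: archi_boundP.
  by rewrite divr_ge0 // ltW.
have g0 : (0 < g)%N.
  by rewrite lt0n; apply/eqP => gE; move: hg; rewrite gE mulr0; lra.
have [|m0 Hm0] := @tile_all q (4 * g); first by rewrite muln_gt0.
exists (q.+2 * (m0 + 2) + 32 * g)%N => G n cG nbig /dvdnP[m nE] hdeg.
rewrite mulnC in nE; rewrite {n}nE in cG nbig hdeg.
(* Both [32 * d] and 1 are at most [n / g], and [2 * n / g <= gamma * n]; so the slack covers
   [16 * (2 * d)] and the surplus 1 in [rich_degrees]. *)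
pose d := ((q.+2 * m) %/ (32 * g))%N.
have d32 : (32 * g * d <= q.+2 * m)%N by rewrite mulnC leq_divM.
have mbig : (m0 + 2 <= m)%N.
  by rewrite -(leq_pmul2l (ltn0Sn q.+1)) (leq_trans _ nbig) ?leq_addr.
have d0 : (0 < d)%N.
  by rewrite divn_gt0 ?muln_gt0 // (leq_trans _ nbig) ?leq_addl.
have nd : (q.+2 * m <= 16 * (4 * g) * d)%N.
  have : (q.+2 * m < d.+1 * (32 * g))%N by rewrite ltn_ceil // muln_gt0.
  by move: d0; move: (q.+2 * m)%N (d) => x y; clear; nia.
apply: packing_of_tileable.
apply: (Hm0 _ _ _ m d) => //; first by apply: leq_trans mbig; rewrite leq_addr.
apply: rich_degrees => //; first by apply: leq_trans mbig; rewrite leq_addl.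
move=> i i0 im.
have r0 : (q.+2)%:R != 0 :> R by rewrite pnatr_eq0.
have := hdeg i i0; rewrite natrM [_ * m%:R]mulrC mulfK // ltr_nat => /(_ im).
have -> : ((q.+2)%:R - 2) * (m%:R * (q.+2)%:R) / (q.+2)%:R = (q * m)%:R :> R.
  by rewrite mulrA mulfK // natrM -addn2 natrD addrK.
move=> h; rewrite -(ler_nat R); apply: le_trans h.
have -> : m%:R * (q.+2)%:R = (q.+2 * m)%:R :> R by rewrite natrM mulrC.
set n := (q.+2 * m)%N in d32 *.
have h1 : 32 * g%:R * d%:R <= n%:R :> R by rewrite -!natrM ler_nat.
have h2 : g%:R <= n%:R :> R.
  rewrite ler_nat; apply: leq_trans d32; rewrite mulnAC leq_pmull //.
  by rewrite muln_gt0.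
have g0' : 0 < g%:R :> R by rewrite ltr0n.
suff : 32 * d%:R + 1 <= gamma * n%:R.
  rewrite -addn1 !natrD !natrM; lra.
rewrite -(ler_pM2l g0').
have h3 : 2 * n%:R <= gamma * g%:R * n%:R by rewrite ler_wpM2r // ltW.
lra.
Qed.
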